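(* Let $\mathcal{CL}\subset\mathbb{P}^2_{\mathbb{C}}$ be an $\mathscr{M}$-arrangement of $d\geq 3$ lines and one smooth conic $C$ with only ordinary singularities of multiplicity at most $4$. Let $\mathcal{L}=\mathcal{CL}\setminus\{C\}$ be the arrangement of the $d$ lines, and let $r=|C\cap\mathcal{L}|$ be the number of distinct points of $C$ lying on at least one of the lines (assumed finite). 1. If $d=2\ell\geq 4$, then $\mathfrak{P}(\mathcal{L};t)=(\ell^2+\ell-2-r)t^2+(2\ell-1)t+1$. 2. If $d=2\ell+1\geq 3$, then $\mathfrak{P}(\mathcal{L};t)=(\ell^2+2\ell-r)t^2+2\ell t+1$.
   Context: An arrangement of conics and lines is a finite set of pairwise distinct smooth conics and lines in $\mathbb{P}^2_{\mathbb{C}}$, identified with the reduced curve $\{f=0\}$ that is their union; with one conic and $d$ lines its degree is $d+2$. A singular point of this curve is ordinary of multiplicity $s$ if exactly $s$ curves of the arrangement pass through it and their tangent lines there are pairwise distinct. For a reduced curve $C=\{f=0\}$, $J_f=\langle\partial_x f,\partial_y f,\partial_z f\rangle$ is the Jacobian ideal, and $\deg J_f$ is the degree of the scheme it defines, i.e. the total Tjurina number $\tau(C)=\sum_{p\in\mathrm{Sing}(C)}\tau_p$. (An ordinary point of multiplicity $s\le 4$ has $\tau_p=(s-1)^2$.) An arrangement of degree $e\geq 5$ with only ordinary singularities of multiplicity at most $4$ is an $\mathscr{M}$-arrangement (its union is an $\mathscr{M}$-curve) if it has at least one ordinary quadruple point and $$\deg J_f=\begin{cases}3m^2-3m+3 &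 \text{if } e=2m\geq 6,\\ 3m^2+1 & \text{if } e=2m+1\geq 5.\end{cases}$$ The combinatorial Poincaré polynomial of an arrangement $\mathcal{A}$ of $k$ smooth conics and $d$ lines with only ordinary intersection points is $$\mathfrak{P}(\mathcal{A};t)=1+(2k+d-1)t+\Big(\sum_{s\geq 2}(s-1)n_s-d+1\Big)t^2,$$ where $n_s$ is the number of points lying on exactly $s$ curves of $\mathcal{A}$; for the line arrangement $\mathcal{L}$ one takes $k=0$ and the $n_s$ are those of $\mathcal{L}$. *)

(* Defs.v *)
From HB Require Import structures.
From mathcomp Require Import all_boot all_order all_algebra.
From mathcomp Require Import fraction complex mpoly.
From mathcomp Require Import finmap boolp classical_sets cardinality reals.

Set Implicit Arguments.
Unset Strict Implicit.
Unset Printing Implicit Defensive.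

Import Order.TTheory GRing.Theory Num.Theory.

Local Open Scope ring_scope.
Local Open Scope classical_set_scope.

(* Points of the projective plane are the lines through the origin of K^3. *)
Record proj_plane (K : fieldType) := ProjPoint {
  point_space : {vspace 'rV[K]_3};
  _ : \dim point_space == 1%N
}.

HB.instance Definition _ (K : fieldType) :=
  [isSub for @point_space K].
HB.instance Definition _ (K : fieldType) := [Choice of proj_plane K by <:].

Section ProjectivePlane.
Context {K : numClosedFieldType}.
Implicit Types (F : {mpoly K[3]}) (p q : proj_plane K).
Implicit Types I : set {mpoly K[3]}.

(* Homogeneous coordinates of p: those of an arbitrary nonzero vector of p.
   Everything below applies them to homogeneous polynomials (or to all the
   elements of a homogeneous ideal), so that the choice is immaterial. *)
Definition hcoord p : 'I_3 -> K := fun i => vpick (point_space p) ord0 i.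

Definition lies_on F p : bool := F.@[hcoord p] == 0.

Definition zeros F : set (proj_plane K) := [set p | lies_on F p].

Definition is_line F : Prop := F \is 1.-homog /\ F != 0.

Definition smooth_conic F : Prop :=
  F \is 2.-homog /\
  forall p, lies_on F p -> exists i : 'I_3, F^`M(i).@[hcoord p] != 0.

(* This is a line when p is a smooth point of F. *)
Definition tangent_line F p : set (proj_plane K) :=
  [set q | \sum_(i < 3) F^`M(i).@[hcoord p] * hcoord q i = 0].

Definition singular_point F p : Prop :=
  lies_on F p /\ forall i : 'I_3, F^`M(i).@[hcoord p] = 0.

Definition jacobian_ideal F : set {mpoly K[3]} :=
  [set g | exists c : 'I_3 -> {mpoly K[3]}, g = \sum_(i < 3) c i * F^`M(i)].

Definition zero_locus I : set (proj_plane K) :=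
  [set p | forall g, I g -> lies_on g p].

(* The degree 0 part of the homogeneous localization of I at p, inside the
   field of fractions of K[x,y,z]. For I = setT this is the local ring of the
   projective plane at p; for a homogeneous ideal I it is the stalk at p of
   the ideal sheaf associated with I. *)
Definition stalk I p : set {fraction {mpoly K[3]}} :=
  [set x | exists n (a b : {mpoly K[3]}),
     [/\ a \is n.-homog, b \is n.-homog, I a, ~~ lies_on b p
       & x = tofrac a / tofrac b]].

(* The local ring at p of the subscheme defined by I, i.e. the quotient
   stalk setT p / stalk I p, has dimension N over K: the classes of some
   e_0, ..., e_(N-1) form a basis of it. When I is the Jacobian ideal of F,
   it is the Tjurina algebra of F at p. *)
Definition local_length I p (N : nat) : Prop :=
  exists e : 'I_N -> {fraction {mpoly K[3]}},
    (forall i, stalk setT p (e i)) /\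
    forall x, stalk setT p x ->
      exists! c : 'rV[K]_N,
        stalk I p (x - \sum_(i < N) tofrac (c ord0 i)%:MP * e i).

(* The subscheme defined by I is finite, of degree N. *)
Definition has_degree I (N : nat) : Prop :=
  finite_set (zero_locus I) /\
  exists tau : proj_plane K -> nat,
    (forall p, zero_locus I p -> local_length I p (tau p)) /\
    N = (\sum_(p <- fset_set (zero_locus I)) tau p)%N.

End ProjectivePlane.

(* k smooth conics, indexed by the left summand, and d lines. *)
Record arrangement (K : numClosedFieldType) (k d : nat) := Arrangement {
  curve :> 'I_k + 'I_d -> {mpoly K[3]};
  curve_conic : forall i : 'I_k, smooth_conic (curve (inl i));
  curve_line : forall j : 'I_d, is_line (curve (inr j));
  curve_distinct : injective (fun i => zeros (curve i))
}.

Section Arrangements.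
Context {K : numClosedFieldType} {k d : nat}.
Implicit Types (A : arrangement K k d) (p : proj_plane K).

Definition arr_poly A : {mpoly K[3]} := \prod_i A i.

Definition arr_degree A : nat := (2 * k + d)%N.

Definition num_through A p : nat := #|[set i | lies_on (A i) p]%SET|.

Definition ordinary_point A p (s : nat) : Prop :=
  [/\ singular_point (arr_poly A) p,
      num_through A p = s
    & forall i j, i != j -> lies_on (A i) p -> lies_on (A j) p ->
        tangent_line (A i) p <> tangent_line (A j) p].

Definition only_ordinary A (m : nat) : Prop :=
  forall p, singular_point (arr_poly A) p ->
    exists2 s, (s <= m)%N & ordinary_point A p s.

Definition M_arrangement A : Prop :=
  [/\ (5 <= arr_degree A)%N,
      only_ordinary A 4,
      exists p, ordinary_point A p 4
    & forall m,
        (arr_degree A = 2 * m ->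
         has_degree (jacobian_ideal (arr_poly A)) (3 * m ^ 2 - 3 * m + 3))%N /\
        (arr_degree A = 2 * m + 1 ->
         has_degree (jacobian_ideal (arr_poly A)) (3 * m ^ 2 + 1))%N].

(* Meaningful for s >= 2, where the set of points is finite. *)
Definition num_points A (s : nat) : nat :=
  #|` fset_set [set p | num_through A p = s] |%N.

(* At most k + d curves pass through a point, so n_s = 0 for s > k + d. *)
Definition poincare A : {poly int} :=
  1 + ((2 * k + d)%N%:Z - 1) *: 'X
  + (\sum_(2 <= s < (k + d).+1) (s%:Z - 1) * (num_points A s)%:Z
     - d%:Z + 1) *: 'X^2.

Definition line_index (i : 'I_0 + 'I_d) : 'I_k + 'I_d :=
  match i with
  | inl i => inl (widen_ord (leq0n k) i)
  | inr j => inr j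
  end.

Lemma line_index_inj : injective line_index.
Proof. by move=> [[]//|i] [[]//|j] [->]. Qed.

Definition lines_of A : arrangement K 0 d :=
  @Arrangement K 0 d (fun i => A (line_index i))
    (fun i => curve_conic A (widen_ord (leq0n k) i))
    (fun j => curve_line A j)
    (fun i j e => line_index_inj (curve_distinct e)).

End Arrangements.

Definition conic_line_points (K : numClosedFieldType) (d : nat)
    (A : arrangement K 1 d) : set (proj_plane K) :=
  [set p | lies_on (A (inl ord0)) p /\ exists j : 'I_d, lies_on (A (inr j)) p].

(* Main.v *)
Require Import Defs.
From HB Require Import structures.
From mathcomp Require Import all_boot all_order all_algebra.
From mathcomp Require Import fraction complex mpoly.
From mathcomp Require Import finmap boolp classical_sets cardinality reals.
From mathcomp Require Import separable ring zify.

(* The only local input is that an ordinary point of multiplicity s <= 4 has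
   Tjurina number (s - 1)^2. Let n = s - 1. The leading forms a, b of the two
   partial derivatives g1, g2 are coprime binary forms of degree n. Bezout and
   Nakayama give m^(2n-1) in (g1, g2), and since s + 1 >= 2n - 1, Euler's relation
   puts the equation of the curve in (g1, g2) + m^(2n-1). As A a + B b = 0 is
   impossible with deg A, deg B < n, the ideal (g1, g2)/m^(2n-1) has dimension
   2 C(n, 2), so the Tjurina algebra has dimension C(2n, 2) - 2 C(n, 2) = n^2.

   Globally, Bezout gives sum_p s_p (s_p - 1) = d (d - 1) + 4 d over the multiple
   points. Subtracting deg J_f = sum_p (s_p - 1)^2 leaves sum_p (s_p - 1), and
   removing the conic lowers this sum by one for each of the r points of C on
   the lines. *)

Set Implicit Arguments.
Unset Strict Implicit.
Unset Printing Implicit Defensive.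

Import Order.TTheory GRing.Theory Num.Theory.

Local Open Scope ring_scope.

(** * Dimension of a quotient *)

(** The stalks in the statement are subsets of the fraction field of K[x,y,z] and come without local
    coordinates or power series. The local computation is therefore done over an axiomatised
    filtration of a subset of a field, and the axioms are verified once, on the blow-up of the
    point: a fraction lies in the k-th power of the maximal ideal when its pulled-back numerator is
    divisible by t^k, where t = 0 is the exceptional divisor. In this chart a binary form becomes a
    polynomial in the slope w, so coprimality, division and Bezout relations are those of K[w]. The
    price is that no branch may be tangent to the direction w = infinity, since the leading form
    would lose degree; a generic basis of K^3 avoids this. Ordinariness enters as distinct slopes:
    the leading form then has simple roots and is coprime to its derivative, and this passes to the
    leading forms of the two partial derivatives. *)

Section QuotientDimension.
Context {K L : fieldType} (kappa : {rmorphism K -> L}).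
Implicit Types (U V W : set L).

(** This has the shape of [local_length], with the two stalks replaced by arbitrary sets of a field,
    so that no quotient space has to be built. *)
Definition quotient_dim V U (N : nat) : Prop :=
  exists e : 'I_N -> L,
    (forall i, V (e i)) /\
    forall x, V x ->
      exists! c : 'rV[K]_N, U (x - \sum_(i < N) kappa (c ord0 i) * e i).

Record is_subspace U : Prop := IsSubspace {
  subspace0 : U 0;
  subspaceD : forall a b, U a -> U b -> U (a + b);
  subspaceZ : forall c a, U a -> U (kappa c * a)
}.

Lemma subspaceN U a : is_subspace U -> U a -> U (- a).
Proof. by move=> sU Ua; rewrite -mulN1r -(rmorphN1 kappa); apply: subspaceZ. Qed.

Lemma subspaceB U a b : is_subspace U -> U a -> U b -> U (a - b).
Proof. by move=> sU Ua Ub; apply: subspaceD => //; apply: subspaceN. Qed.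

Lemma subspace_sum U (I : Type) (r : seq I) (P : pred I) (F : I -> L) :
  is_subspace U -> (forall i, P i -> U (F i)) -> U (\sum_(i <- r | P i) F i).
Proof.
by move=> sU UF; apply: (big_ind U) => //; [apply: subspace0|move=> ? ?; apply: subspaceD].
Qed.

Lemma subspace_comb U (N : nat) (c : 'I_N -> K) (e : 'I_N -> L) :
  is_subspace U -> (forall i, U (e i)) -> U (\sum_i kappa (c i) * e i).
Proof. by move=> sU Ue; apply: subspace_sum => // i _; apply: subspaceZ. Qed.

Lemma quotient_dimP V U (N : nat) (e : 'I_N -> L) :
    is_subspace U -> (forall i, V (e i)) ->
    (forall x, V x -> exists c : 'I_N -> K, U (x - \sum_i kappa (c i) * e i)) ->
    (forall c : 'I_N -> K, U (\sum_i kappa (c i) * e i) -> forall i, c i = 0) ->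
  quotient_dim V U N.
Proof.
move=> sU Ve span free; exists e; split=> // x Vx.
have [c Uc] := span x Vx; exists (\row_i c i); split=> [|c' Uc'].
  by under eq_bigr do rewrite mxE.
apply/rowP => i; rewrite mxE; apply/eqP; rewrite -subr_eq0; apply/eqP.
apply: (free (fun i => c i - c' ord0 i)).
under eq_bigr do rewrite rmorphB mulrBl; rewrite sumrB.
set s := \sum_i _ in Uc *; set s' := \sum_i _ in Uc' *.
by rewrite -[s - s'](_ : (x - s') - (x - s) = _); [apply: subspaceB|ring].
Qed.

(** The zero row and [c] both represent the combination modulo [U], so uniqueness identifies
    them. *)
Lemma quotient_dim_free V U (N : nat) (e : 'I_N -> L) :
    is_subspace V -> is_subspace U -> (forall i, V (e i)) ->
    (forall x, V x ->
      exists! c : 'rV[K]_N, U (x - \sum_(i < N) kappa (c ord0 i) * e i)) ->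
  forall c : 'I_N -> K, U (\sum_i kappa (c i) * e i) -> forall i, c i = 0.
Proof.
move=> sV sU Ve span c Uc i.
have [c0 [_ uniq]] := span _ (subspace_comb c sV Ve).
have e1 : c0 = 0.
  apply: uniq; rewrite [X in _ - X]big1 ?subr0 //.
  by move=> j _; rewrite mxE rmorph0 mul0r.
have e2 : c0 = \row_j c j.
  apply: uniq; under [X in _ - X]eq_bigr do rewrite mxE.
  by rewrite subrr; apply: (subspace0 sU).
by move/rowP: e1 => /(_ i); rewrite e2 !mxE.
Qed.

(** Expressing [e'] through [e] and back gives two matrices whose product is the identity modulo
    [U]; freeness of [e'] makes this an equality, and the identity of size M then factors through
    K^N. *)
Lemma quotient_dim_le V U (N M : nat) : is_subspace V -> is_subspace U ->
  quotient_dim V U N -> quotient_dim V U M -> (M <= N)%N.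
Proof.
move=> sV sU [e [Ve espan]] [e' [Ve' espan']].
have free' := quotient_dim_free sV sU Ve' espan'.
have /choice[P UP] j : exists c : 'rV[K]_N, U (e' j - \sum_i kappa (c ord0 i) * e i).
  by have [c [Uc _]] := espan _ (Ve' j); exists c.
have /choice[Q UQ] i : exists c : 'rV[K]_M, U (e i - \sum_j kappa (c ord0 j) * e' j).
  by have [c [Uc _]] := espan' _ (Ve i); exists c.
apply: (@mulmx1_min _ _ _ (\matrix_(j, i) P j ord0 i) (\matrix_(i, j) Q i ord0 j)).
apply/matrixP => j k; rewrite !mxE; apply/eqP; rewrite -subr_eq0; apply/eqP.
under eq_bigr do rewrite !mxE.
apply: (free' (fun k => \sum_i P j ord0 i * Q i ord0 k - (j == k)%:R)).
have -> : \sum_l kappa (\sum_i P j ord0 i * Q i ord0 l - (j == l)%:R) * e' l =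
   - (e' j - \sum_i kappa (P j ord0 i) * e i)
   - \sum_i kappa (P j ord0 i) * (e i - \sum_l kappa (Q i ord0 l) * e' l).
  under [X in _ = _ - X]eq_bigr do rewrite mulrBr mulr_sumr.
  rewrite [X in _ = _ - X]sumrB [X in _ = _ - (_ - X)]exchange_big /=.
  under eq_bigr do rewrite rmorphB mulrBl rmorph_sum mulr_suml.
  rewrite [LHS]sumrB [X in _ - X = _](bigD1 j) //= eqxx rmorph1 mul1r.
  rewrite [X in _ - (_ + X) = _]big1; last first.
    by move=> l /negPf; rewrite eq_sym => ->; rewrite rmorph0 mul0r.
  under eq_bigr do under eq_bigr do rewrite rmorphM -mulrA.
  by rewrite addr0; set u := \sum_i _; set v := \sum_i _; ring.
apply: subspaceB => //; first by apply: subspaceN.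
by apply: subspace_sum => // i _; apply: subspaceZ.
Qed.

Lemma quotient_dim_unique V U (N M : nat) : is_subspace V -> is_subspace U ->
  quotient_dim V U N -> quotient_dim V U M -> N = M.
Proof. by move=> sV sU dN dM; apply/eqP; rewrite eqn_leq !(@quotient_dim_le V U). Qed.

Definition glue (T : Type) (N M : nat) (e : 'I_N -> T) (e' : 'I_M -> T)
    (i : 'I_(N + M)) : T :=
  match split i with inl j => e j | inr j => e' j end.

Lemma glue_lshift (T : Type) (N M : nat) (e : 'I_N -> T) (e' : 'I_M -> T) i :
  glue e e' (lshift M i) = e i.
Proof. by rewrite /glue (unsplitK (inl i)). Qed.

Lemma glue_rshift (T : Type) (N M : nat) (e : 'I_N -> T) (e' : 'I_M -> T) i :
  glue e e' (rshift N i) = e' i.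
Proof. by rewrite /glue (unsplitK (inr i)). Qed.

Lemma sum_glue (N M : nat) (e : 'I_N -> L) (e' : 'I_M -> L) (c : 'I_(N + M) -> K) :
  \sum_i kappa (c i) * glue e e' i =
   \sum_i kappa (c (lshift M i)) * e i + \sum_j kappa (c (rshift N j)) * e' j.
Proof.
rewrite big_split_ord /=; congr (_ + _); apply: eq_bigr => i _.
  by rewrite glue_lshift.
by rewrite glue_rshift.
Qed.

(** A basis of U/W appended to one of V/U is a basis of V/W. For freeness, reducing a relation
    modulo U kills the first N coefficients, and what remains is a relation in U/W. *)
Lemma quotient_dim_add V U W (N M : nat) :
    is_subspace V -> is_subspace U -> is_subspace W ->
    (forall a, U a -> V a) -> (forall a, W a -> U a) ->
  quotient_dim V U N -> quotient_dim U W M -> quotient_dim V W (N + M).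
Proof.
move=> sV sU sW UV WU [e [Ve espan]] [e' [Ue' espan']].
have free := quotient_dim_free sV sU Ve espan.
have free' := quotient_dim_free sU sW Ue' espan'.
apply: (@quotient_dimP V W _ (glue e e')) => //.
- by move=> i; rewrite /glue; case: (split i) => // j; apply: UV.
- move=> a Va; have [c [Uc _]] := espan _ Va; have [c' [Wc' _]] := espan' _ Uc.
  exists (glue (c ord0) (c' ord0)); rewrite sum_glue opprD addrA.
  by under eq_bigr do rewrite glue_lshift; under [X in _ - X]eq_bigr do rewrite glue_rshift.
- move=> c; rewrite sum_glue => Wc.
  have U' : U (\sum_j kappa (c (rshift N j)) * e' j) by apply: subspace_comb.
  have c1 : forall i, c (lshift M i) = 0.
    apply: (free (fun i => c (lshift M i))).
    have := subspaceB sU (WU _ Wc) U'.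
    by rewrite addrK.
  have c2 : forall i, c (rshift N i) = 0.
    apply: (free' (fun i => c (rshift N i))).
    by move: Wc; rewrite big1 ?add0r // => i _; rewrite c1 rmorph0 mul0r.
  by move=> i; rewrite -(splitK i); case: (split i) => j /=.
Qed.

End QuotientDimension.

(** * Regular local rings of dimension two *)

Lemma poly_sum_wide (R : nzRingType) (k : nat) (q : {poly R}) : (size q <= k)%N ->
  q = \sum_(i < k) q`_i *: 'X^i.
Proof.
move=> sq; rewrite -poly_def; apply/polyP => i; rewrite coef_poly.
by case: ltnP => // /(leq_trans sq)/leq_sizeP->.
Qed.

Section LocalFiltration.
Context {K L : fieldType} (kappa : {rmorphism K -> L}).
Context (O : nat -> set L) (x w : L).

Definition form (k : nat) (q : {poly K}) : L := x ^+ k * (map_poly kappa q).[w].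

(* [O 0] is a regular local ring of dimension 2 with parameters [x] and [x * w],
   [O k] is the k-th power of its maximal ideal, and [form k q] is the value at
   the parameters of the binary form of degree k that dehomogenizes to [q]. *)
Record local_filtration : Prop := LocalFiltration {
  filtC : forall c, O 0 (kappa c);
  filtD : forall k a b, O k a -> O k b -> O k (a + b);
  filtM : forall j k a b, O j a -> O k b -> O (j + k) (a * b);
  filtS : forall k a, O k.+1 a -> O k a;
  filt_inv : forall a, O 1 a -> O 0 (1 - a)^-1;
  filt_x : O 1 x;
  filt_xw : O 1 (x * w);
  filt_form0 : forall k (q : {poly K}),
    (size q <= k.+1)%N -> O k.+1 (form k q) -> q = 0;
  filt_residue : forall a, O 0 a -> exists c, O 1 (a - kappa c);
  filt_gen : forall a, O 1 a ->
    exists b c, [/\ O 0 b, O 0 c & a = x * b + x * w * c]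
}.

Lemma formM j k p q : form j p * form k q = form (j + k) (p * q).
Proof. by rewrite /form rmorphM hornerM exprD; ring. Qed.

Lemma formD k p q : form k (p + q) = form k p + form k q.
Proof. by rewrite /form rmorphD hornerD mulrDr. Qed.

Lemma formMn k q m : form k (q *+ m) = form k q *+ m.
Proof. by rewrite /form rmorphMn hornerMn mulrnAr. Qed.

Lemma formZ k c q : form k (c *: q) = kappa c * form k q.
Proof. by rewrite /form map_polyZ /= hornerZ mulrCA. Qed.

Lemma form_x k q : form k.+1 q = x * form k q.
Proof. by rewrite /form exprS mulrA. Qed.

Lemma form_xw k q : form k.+1 ('X * q) = x * w * form k q.
Proof. by rewrite /form rmorphM /= map_polyX hornerM hornerX exprS; ring. Qed.

Lemma form_sum k (I : Type) (r : seq I) (P : pred I) (F : I -> {poly K}) :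
  form k (\sum_(i <- r | P i) F i) = \sum_(i <- r | P i) form k (F i).
Proof. by rewrite /form rmorph_sum horner_sum mulr_sumr. Qed.

Hypothesis OF : local_filtration.

Lemma filtZ k c a : O 0 c -> O k a -> O k (c * a).
Proof. exact: (filtM OF). Qed.

Lemma filt_x_exp k : O k (x ^+ k).
Proof.
elim: k => [|k IH]; first by rewrite expr0 -(rmorph1 kappa); apply: filtC.
by rewrite exprS; apply: (filtM OF (filt_x OF) IH).
Qed.

Lemma filt_subspace k : is_subspace kappa (O k).
Proof.
split=> [|a b|c a Oa]; last by apply: filtZ => //; apply: (filtC OF).
  by rewrite -(mul0r (x ^+ k)) -(rmorph0 kappa); apply: filtZ (filtC OF _) (filt_x_exp k).
exact: filtD.
Qed.

Lemma filtB k a b : O k a -> O k b -> O k (a - b).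
Proof. exact: subspaceB (filt_subspace k). Qed.

Lemma filt_sum k (I : Type) (r : seq I) (P : pred I) (F : I -> L) :
  (forall i, P i -> O k (F i)) -> O k (\sum_(i <- r | P i) F i).
Proof. exact: subspace_sum (filt_subspace k). Qed.

Lemma filt_le j k a : (j <= k)%N -> O k a -> O j a.
Proof.
move=> /subnK <-; elim: (k - j)%N => [//|m IH] Oa.
by apply: IH; apply: (filtS OF).
Qed.

(** Although [w] need not lie in the ring, the product is the monomial of degree k in the parameters
    [x] and [x * w] with exponents k - i and i. *)
Lemma filt_monomial k i : (i <= k)%N -> O k (x ^+ k * w ^+ i).
Proof.
elim: k i => [|k IH] [|i] // ik; rewrite ?expr0 ?mulr1; try exact: filt_x_exp.
have -> : x ^+ k.+1 * w ^+ i.+1 = x * w * (x ^+ k * w ^+ i) by rewrite !exprS; ring.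
by apply: (filtM OF (filt_xw OF) (IH _ ik)).
Qed.

Lemma filt_horner j k (Q : {poly L}) : (size Q <= k.+1)%N ->
  (forall i, O j Q`_i) -> O (j + k) (x ^+ k * Q.[w]).
Proof.
move=> sQ OQ; rewrite (horner_coef_wide _ sQ) mulr_sumr.
apply: filt_sum => i _; rewrite mulrCA; apply: (filtM OF) => //.
by apply: filt_monomial; rewrite -ltnS ltn_ord.
Qed.

Lemma filt_form k (q : {poly K}) : (size q <= k.+1)%N -> O k (form k q).
Proof.
move=> sq; rewrite -[k in O k]add0n; apply: filt_horner.
  by rewrite size_map_poly.
by move=> i; rewrite coef_map; apply: filtC.
Qed.

Lemma form_polyE k (q : {poly K}) : (size q <= k.+1)%N ->
  form k q = \sum_(i < k.+1) kappa q`_i * form k 'X^i.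
Proof.
move=> sq; rewrite [in LHS](poly_sum_wide sq) form_sum.
by apply: eq_bigr => i _; rewrite formZ.
Qed.

Lemma filt_lead_gen k (Q : {poly L}) : (size Q <= k.+1)%N -> (forall i, O 0 Q`_i) ->
  exists2 q : {poly K}, (size q <= k.+1)%N & forall i, O 1 (Q - map_poly kappa q)`_i.
Proof.
move=> sQ OQ; have /choice[c Oc] i := filt_residue OF (OQ i).
exists (\poly_(i < k.+1) c i) => [|i]; first exact: size_poly.
rewrite coefB coef_map coef_poly; case: ltnP => // ki.
rewrite raddf0 subr0; move/leq_sizeP: sQ => -> //.
exact: subspace0 (filt_subspace 1).
Qed.

(** Quasi-regularity of the parameters: replacing each coefficient by its residue changes the value
    only by an element of [O k.+1], so the form with constant coefficients lies there too and
    vanishes by [filt_form0]. *)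
Lemma filt_coef k (Q : {poly L}) : (size Q <= k.+1)%N -> (forall i, O 0 Q`_i) ->
  O k.+1 (x ^+ k * Q.[w]) -> forall i, O 1 Q`_i.
Proof.
move=> sQ OQ OkQ; have [q sq OR] := filt_lead_gen sQ OQ.
suff q0 : q = 0 by move: OR; rewrite q0 rmorph0 subr0.
apply: (filt_form0 OF sq).
have -> : form k q = x ^+ k * Q.[w] - x ^+ k * (Q - map_poly kappa q).[w].
  by rewrite /form hornerD hornerN; ring.
apply: filtB => //; rewrite -add1n; apply: filt_horner => //.
by rewrite (leq_trans (size_polyD _ _)) // size_polyN size_map_poly geq_max sQ.
Qed.

(** [O k] is generated by the monomials of degree k. In the induction step [filt_coef] puts the
    coefficients of the degree k expression in [O 1], and each of them is then split along [x] and
    [x * w]. *)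
Lemma filt_gen_pow k a : O k a ->
  exists Q : {poly L}, [/\ (size Q <= k.+1)%N, forall i, O 0 Q`_i & a = x ^+ k * Q.[w]].
Proof.
elim: k a => [|k IH] a Oa.
  exists a%:P; split; first exact: size_polyC_leq1.
    by move=> i; rewrite coefC; case: eqP => // _; apply: subspace0 (filt_subspace 0).
  by rewrite hornerC mul1r.
have [Q [sQ OQ aQ]] := IH _ (filtS OF Oa).
have OR : forall i, O 1 Q`_i by apply: (filt_coef sQ) => //; rewrite -aQ.
have /choice[b /choice[c bc]] i := filt_gen OF (OR i).
exists (\poly_(i < k.+1) b i + 'X * \poly_(i < k.+1) c i); split.
- rewrite (leq_trans (size_polyD _ _)) // geq_max (leq_trans (size_poly _ _)) //=.
  rewrite (leq_trans (size_polyMleq _ _)) // size_polyX add2n /= ltnS; exact: size_poly.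
- have O0 : O 0 0 by apply: subspace0 (filt_subspace 0).
  move=> i; rewrite coefD coefXM !coef_poly; apply: (filtD OF).
    by case: ltnP => // _; case: (bc i).
  by case: eqP => // _; case: ltnP => // _; case: (bc i.-1).
- rewrite aQ hornerD hornerM hornerX exprSr -mulrA; congr (_ * _).
  rewrite !horner_poly mulrDr mulrA !mulr_sumr -big_split /= (horner_coef_wide _ sQ).
  apply: eq_bigr => i _; case: (bc i) => _ _ {1}->; ring.
Qed.

Lemma filt_lead k a : O k a ->
  exists2 q : {poly K}, (size q <= k.+1)%N & O k.+1 (a - form k q).
Proof.
move=> /filt_gen_pow[Q [sQ OQ aQ]]; have [q sq OR] := filt_lead_gen sQ OQ.
exists q => //; have -> : a - form k q = x ^+ k * (Q - map_poly kappa q).[w].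
  by rewrite aQ /form hornerD hornerN; ring.
rewrite -add1n; apply: filt_horner => //.
by rewrite (leq_trans (size_polyD _ _)) // size_polyN size_map_poly geq_max sQ.
Qed.

Lemma filt_form_leadM j k b (p q : {poly K}) : (size p <= j.+1)%N ->
  O k.+1 (b - form k q) -> O (j + k).+1 (form j p * b - form (j + k) (p * q)).
Proof.
move=> sp Obq; rewrite -formM -mulrBr -addnS; apply: (filtM OF) => //.
exact: filt_form.
Qed.

Lemma filt_lead_mem k a (q : {poly K}) : (size q <= k.+1)%N -> O k.+1 (a - form k q) -> O k a.
Proof.
move=> sq Oaq; rewrite -(subrK (form k q) a); apply: (filtD OF); first exact: (filtS OF).
exact: filt_form.
Qed.

Lemma filt_layer_dim k : quotient_dim kappa (O k) (O k.+1) k.+1.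
Proof.
apply: (@quotient_dimP _ _ kappa _ _ _ (fun i : 'I_k.+1 => form k 'X^i)).
- exact: filt_subspace.
- by move=> i; apply: filt_form; rewrite size_polyXn.
- move=> a /filt_lead[q sq Oq]; exists (fun i => q`_i).
  by rewrite -form_polyE.
- move=> c Oc i.
  pose q : {poly K} := \sum_(i < k.+1) c i *: 'X^i.
  have e : \sum_(i < k.+1) kappa (c i) * form k 'X^i = form k q.
    by rewrite form_sum; apply: eq_bigr => j _; rewrite formZ.
  have sz : (size q <= k.+1)%N.
    apply: (leq_trans (size_sum _ _ _)); apply/bigmax_leqP => j _.
    by rewrite (leq_trans (size_scale_leq _ _)) // size_polyXn.
  have /polyP/(_ i) : q = 0 by apply: (filt_form0 OF sz); rewrite -e.
  rewrite coef0 coef_sum (bigD1 i) //= coefZ coefXn eqxx mulr1 big1 ?addr0 //.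
  move=> j ij; rewrite coefZ coefXn -val_eqE eq_sym /= in ij *.
  by rewrite (negPf ij) mulr0.
Qed.

Lemma filt_dim k : quotient_dim kappa (O 0) (O k) 'C(k.+1, 2).
Proof.
elim: k => [|k IH].
  (* 'C(1, 2) is 0, so this family is indexed by the empty type. *)
  apply: (@quotient_dimP _ _ kappa _ _ _ (fun=> 0)).
  - exact: filt_subspace.
  - by case.
  - by move=> a Oa; exists (fun=> 0); rewrite big1 ?subr0 // => -[].
  - by move=> c _ [].
rewrite binS bin1.
apply: (quotient_dim_add _ _ _ _ _ IH (filt_layer_dim k)); try exact: filt_subspace.
  by move=> a; apply: filt_le.
by move=> a; apply: (filtS OF).
Qed.

Record is_ideal (J : set L) : Prop := IsIdeal {
  ideal0 : J 0;
  idealD : forall a b, J a -> J b -> J (a + b);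
  idealM : forall c a, O 0 c -> J a -> J (c * a)
}.

Lemma ideal_subspace J : is_ideal J -> is_subspace kappa J.
Proof.
move=> iJ; split; [exact: ideal0|exact: idealD|].
by move=> c a; apply: idealM iJ _ _ (filtC OF _).
Qed.

(** Elimination of one generator at a time. Modulo [J] enlarged by [M r] the other relations keep
    their form, so the remaining generators lie in [J']; the relation for [M r] then reads (1 - u) *
    M r in [J] with u in [O 1]. *)
Lemma nakayama J r (M : nat -> L) : is_ideal J ->
    (forall i, (i < r)%N -> exists g (u : nat -> L),
       [/\ J g, forall j, O 1 (u j) & M i = g + \sum_(j < r) u j * M j]) ->
  forall i, (i < r)%N -> J (M i).
Proof.
elim: r J => [//|r IH] J iJ MJ.
pose J' : set L := fun a => exists g s, [/\ J g, O 0 s & a = g + s * M r].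
have iJ' : is_ideal J'.
  split.
  - by exists 0, 0; split; rewrite ?mul0r ?addr0 //; [apply: ideal0|apply: subspace0 (filt_subspace 0)].
  - move=> _ _ [g [s [Jg Os ->]]] [g' [s' [Jg' Os' ->]]]; exists (g + g'), (s + s').
    by split; [exact: idealD|exact: filtD|ring].
  - move=> c _ Oc [g [s [Jg Os ->]]]; exists (c * g), (c * s).
    by split; [exact: idealM|exact: filtZ|ring].
have MJ' : forall i, (i < r)%N -> J' (M i).
  apply: IH => // i ir; have [g [u [Jg Ou ->]]] := MJ i (ltnW ir).
  exists (g + u r * M r), u; split=> //.
    by exists g, (u r); split=> //; apply: filtS.
  by rewrite big_ord_recr /=; ring.
have Jr : J (M r).
  have [g [u [Jg Ou Mr]]] := MJ r (ltnSn r).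
  have [g' [s [Jg' Os e]]] : exists g' s,
      [/\ J g', O 1 s & \sum_(j < r) u j * M j = g' + s * M r].
    apply: (big_ind (fun a => exists g' s, [/\ J g', O 1 s & a = g' + s * M r])).
    - exists 0, 0; split; rewrite ?mul0r ?addr0 //; first exact: ideal0.
      exact: subspace0 (filt_subspace 1).
    - move=> _ _ [a [b [Ja Ob ->]]] [a' [b' [Ja' Ob' ->]]]; exists (a + a'), (b + b').
      by split; [exact: idealD|exact: filtD|ring].
    - move=> j _; have [a [b [Ja Ob ->]]] := MJ' j (ltn_ord j).
      exists (u j * a), (u j * b); split; last by ring.
        by apply: idealM => //; apply: filtS.
      exact: (filtM OF (Ou j) Ob).
  have Osu : O 1 (s + u r) by apply: (filtD OF).
  (* Otherwise 1 would lie in [O 1], against [filt_form0] for the constant form 1 of degree 0. *)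
  have nz : 1 - (s + u r) != 0.
    apply/eqP => /eqP; rewrite subr_eq0 => /eqP e1.
    have := @filt_form0 OF 0 1; rewrite size_poly1 /form rmorph1 hornerC mulr1 expr0 e1.
    by move=> /(_ isT Osu)/eqP; rewrite oner_eq0.
  rewrite (_ : M r = (1 - (s + u r))^-1 * (g + g')).
    by apply: idealM; [|exact: filt_inv|exact: idealD].
  apply: (mulfI nz); rewrite mulVKf //.
  by rewrite mulrBl mul1r {1}(_ : M r = g + (g' + s * M r + u r * M r)); [ring|rewrite {1}Mr big_ord_recr /= e].
move=> i; rewrite ltnS leq_eqVlt => /orP[/eqP-> //|/MJ'[g [s [Jg Os ->]]]].
by apply: idealD => //; apply: idealM.
Qed.

End LocalFiltration.

(** * The Tjurina number of an ordinary point *)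

Lemma size_polyM_le (R : nzRingType) (p q : {poly R}) (i j : nat) :
  (size p <= i)%N -> (size q <= j.+1)%N -> (size (p * q)%R <= i + j)%N.
Proof.
move=> pi qj; rewrite (leq_trans (size_polyMleq _ _)) // -subn1 leq_subLR.
by rewrite add1n -addnS leq_add.
Qed.

Section OrdinaryPoint.
Context {K L : fieldType} (kappa : {rmorphism K -> L}).
Context (O : nat -> set L) (x w : L).
Hypothesis OF : local_filtration kappa O x w.
Local Notation form := (form kappa x w).

(* The curve f has order n + 1 at the point, with leading form P; those of its
   partial derivatives are then [lead_x] and [P^`()]. *)
Context (n : nat) (P : {poly K}).
Hypothesis sizeP : size P = n.+2.
Hypothesis P_sqfree : coprimep P P^`().
Hypothesis char_n : n.+1%:R != 0 :> K.

(** The x-derivative of the binary form x^(n+1) P(y/x), dehomogenized at w = y/x. Its coefficients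
    of index n + 1 cancel, so it is a form of degree n. *)
Definition lead_x : {poly K} := P *+ n.+1 - 'X * P^`().
Local Notation a := lead_x.
Local Notation b := (P^`()).

Lemma size_lead_y : size b = n.+1.
Proof.
apply/eqP; rewrite eqn_leq; apply/andP; split.
  by rewrite -ltnS -sizeP lt_size_deriv // -size_poly_eq0 sizeP.
rewrite ltnNge; move: char_n; apply: contraNN => /leq_sizeP/(_ n (leqnn n))/eqP.
rewrite coef_deriv -(mulr_natr P`_n.+1) mulf_eq0 => /orP[|//].
have -> : P`_n.+1 = lead_coef P by rewrite lead_coefE sizeP.
by rewrite lead_coef_eq0 -size_poly_eq0 sizeP.
Qed.

Lemma size_lead_x : (size a <= n.+1)%N.
Proof.
apply/leq_sizeP => j; rewrite leq_eqVlt => /orP[/eqP<-|nj].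
  by rewrite /lead_x coefB coefMn coefXM coef_deriv subrr.
have Pj : P`_j = 0 by move: sizeP => /eq_leq/leq_sizeP->.
by rewrite /lead_x coefB coefMn coefXM coef_deriv; case: j nj Pj => // j _ /= ->; rewrite !mul0rn subrr.
Qed.

(** Modulo [b] the polynomial [a] is (n + 1) P, so a Bezout relation for P and its derivative
    transfers after division by n + 1. *)
Lemma coprime_lead : coprimep a b.
Proof.
have /Bezout_eq1_coprimepP[[u v] /= uv] := P_sqfree.
apply/Bezout_eq1_coprimepP; exists (n.+1%:R^-1 *: u, n.+1%:R^-1 *: (u * 'X) + v) => /=.
have <- : (n.+1%:R^-1 : K) *: (u * (P *+ n.+1)) + v * b = 1.
  by rewrite -[P *+ _]scaler_nat -scalerAr scalerA mulVf // scale1r.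
by rewrite /lead_x -!mul_polyC; ring.
Qed.

Lemma syzygy_lead (A B : {poly K}) : (size A <= n)%N -> A * a + B * b = 0 ->
  A = 0 /\ B = 0.
Proof.
move=> sA AB; have b0 : b != 0 by rewrite -size_poly_eq0 size_lead_y.
have bA : b %| A.
  rewrite -(@Gauss_dvdpl _ A a b); last by rewrite coprimep_sym coprime_lead.
  by rewrite (_ : A * a = - (B * b)) ?dvdpNr ?dvdp_mull //; apply/eqP; rewrite -addr_eq0 AB.
have A0 : A = 0.
  apply/eqP/negPn/negP => /dvdp_leq/(_ bA); rewrite size_lead_y leqNgt => /negP; exact.
split=> //; move/eqP: AB; rewrite A0 mul0r add0r mulf_eq0 (negPf b0) orbF.
by move/eqP.
Qed.

(** The cofactor of [a] is reduced modulo [b], which has degree exactly n. The bound on the other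
    cofactor follows by degree from B b = q - A a. *)
Lemma bezout_lead (q : {poly K}) : (size q <= n.*2)%N ->
  exists A B : {poly K}, [/\ (size A <= n)%N, (size B <= n)%N & q = A * a + B * b].
Proof.
move=> sq; have b0 : b != 0 by rewrite -size_poly_eq0 size_lead_y.
have /Bezout_eq1_coprimepP[[u v] /= uv] := coprime_lead.
have sA : (size (q * u %% b)%R <= n)%N.
  by rewrite -ltnS -size_lead_y ltn_modp.
have e : q = (q * u %% b) * a + ((q * u %/ b) * a + q * v) * b.
  rewrite -{1}[q]mulr1 -uv mulrDr !mulrA {1}(divp_eq (q * u) b); ring.
exists (q * u %% b), ((q * u %/ b) * a + q * v); split=> //.
set B := _ + q * v in e *; have [->|B0] := eqVneq B 0; first by rewrite size_poly0.
have sBb : (size (B * b)%R <= n.*2)%N.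
  rewrite (_ : B * b = q - (q * u %% b) * a); last by rewrite {1}e; ring.
  rewrite (leq_trans (size_polyD _ _)) // geq_max sq size_polyN.
  by rewrite -addnn size_polyM_le // size_lead_x.
by move: sBb; rewrite size_mul // size_lead_y addnS -addnn leq_add2r.
Qed.

Context (g1 g2 f : L).
Hypothesis lead_f : O n.+2 (f - form n.+1 P).
Hypothesis lead_g1 : O n.+1 (g1 - form n a).
Hypothesis lead_g2 : O n.+1 (g2 - form n b).

Lemma filt_g1 : O n g1.
Proof. by apply: (filt_lead_mem OF size_lead_x). Qed.

Lemma filt_g2 : O n g2.
Proof. by apply: (filt_lead_mem OF _ lead_g2); rewrite size_lead_y. Qed.

(** [syzygy_lead] lifted to the local ring, for the freeness in [jacobian_filt_dim]. Once both
    coefficients have order m, with m + n < 2n - 1, their forms of degree m give a syzygy of the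
    leading forms in too low a degree, so they vanish and the order rises. *)
Lemma syzygy_filt m al be : (m + n <= n.*2.-1)%N -> O 0 al -> O 0 be ->
  O n.*2.-1 (al * g1 + be * g2) -> O m al /\ O m be.
Proof.
move=> mn Oal Obe Og; elim: m mn => [//|m IH] mn.
have [] := IH (ltnW mn) => /(filt_lead OF)[A sA OA] /(filt_lead OF)[B sB OB].
suff [A0 B0] : A = 0 /\ B = 0.
  by move: OA OB; rewrite A0 B0 /form !rmorph0 !horner0 !mulr0 !subr0.
have sA' : (size A <= n)%N by lia.
apply: syzygy_lead sA' _; apply: (@filt_form0 _ _ _ _ _ _ OF (m + n)).
  rewrite (leq_trans (size_polyD _ _)) // geq_max; apply/andP; split.
    by rewrite -addSn size_polyM_le // size_lead_x.
  by rewrite -addSn size_polyM_le // size_lead_y.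
(* The form differs from the given combination only by terms of order m + n + 1. *)
have -> : form (m + n) (A * a + B * b) = al * g1 + be * g2
   - ((al - form m A) * g1 + (be - form m B) * g2)
   - ((form m A * g1 - form (m + n) (A * a)) + (form m B * g2 - form (m + n) (B * b))).
  by rewrite formD; ring.
apply: (filtB OF); first apply: (filtB OF).
- by apply: (filt_le OF) Og; lia.
- by apply: (filtD OF); rewrite -addSn; apply: (filtM OF) => //; [exact: filt_g1|exact: filt_g2].
- by apply: (filtD OF); apply: (filt_form_leadM OF).
Qed.

Definition jacobian_stalk : set L := fun s =>
  exists al be ga, [/\ O 0 al, O 0 be, O 0 ga & s = al * g1 + be * g2 + ga * f].

Lemma jacobian_stalk_ideal : is_ideal O jacobian_stalk.
Proof.
have O0 : O 0 0 by apply: subspace0 (filt_subspace OF 0).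
split.
- by exists 0, 0, 0; split=> //; ring.
- move=> _ _ [a1 [b1 [c1 [? ? ? ->]]]] [a2 [b2 [c2 [? ? ? ->]]]].
  by exists (a1 + a2), (b1 + b2), (c1 + c2); split; try exact: (filtD OF); ring.
- move=> c _ Oc [a1 [b1 [c1 [? ? ? ->]]]].
  by exists (c * a1), (c * b1), (c * c1); split; try exact: (filtZ OF); ring.
Qed.

(** By [bezout_lead] each monomial of degree 2n - 1 is a combination of [g1] and [g2] up to order
    2n; the error is a combination of the same monomials with coefficients in [O 1], as Nakayama
    requires. *)
Lemma filt_sub_jacobian s : (0 < n)%N -> O n.*2.-1 s -> jacobian_stalk s.
Proof.
move=> n0 Os; pose k := n.*2.-1; have kE : k = (n.-1 + n)%N by rewrite /k; lia.
have iJ := jacobian_stalk_ideal.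
have OJ (A B : {poly K}) : (size A <= n)%N -> (size B <= n)%N ->
    jacobian_stalk (form n.-1 A * g1 + form n.-1 B * g2).
  move=> sA sB; exists (form n.-1 A), (form n.-1 B), 0; split; last by ring.
  - by apply: (@filt_le _ _ _ _ _ _ OF _ n.-1) => //; apply: (filt_form OF); rewrite prednK.
  - by apply: (@filt_le _ _ _ _ _ _ OF _ n.-1) => //; apply: (filt_form OF); rewrite prednK.
  - exact: subspace0 (filt_subspace OF 0).
have JM : forall i, (i < k.+1)%N -> jacobian_stalk (x ^+ k * w ^+ i).
  apply: (nakayama OF) => // i ik.
  have formXi : x ^+ k * w ^+ i = form k 'X^i by rewrite /form map_polyXn hornerXn.
  have [|A [B [sA sB AB]]] := @bezout_lead 'X^i; first by rewrite size_polyXn; lia.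
  pose t := form k 'X^i - (form n.-1 A * g1 + form n.-1 B * g2).
  have Ot : O k.+1 t.
    have -> : t = - ((form n.-1 A * g1 - form k (A * a)) +
                     (form n.-1 B * g2 - form k (B * b))).
      by rewrite /t AB formD; ring.
    apply: (subspaceN (filt_subspace OF _)); rewrite kE.
    by apply: (filtD OF); apply: (filt_form_leadM OF); rewrite ?prednK.
  have [Q [sQ OQ tQ]] := filt_gen_pow OF (filtS OF Ot).
  exists (form n.-1 A * g1 + form n.-1 B * g2), (fun i => Q`_i); split.
  - exact: OJ.
  - by apply: (filt_coef OF sQ) => //; rewrite -tQ.
  - rewrite formXi -[LHS](subrK (form n.-1 A * g1 + form n.-1 B * g2)) -/t addrC tQ.
    congr (_ + _); rewrite (horner_coef_wide _ sQ) mulr_sumr.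
    by apply: eq_bigr => j _; rewrite mulrCA.
have [Q [sQ OQ ->]] := filt_gen_pow OF Os.
rewrite (horner_coef_wide _ sQ) mulr_sumr.
apply: (subspace_sum _ (ideal_subspace OF iJ)) => i _; rewrite mulrCA.
by apply: (idealM iJ) => //; apply: JM; rewrite ltn_ord.
Qed.

(* Euler's relation on leading forms; [n + 2 >= 2 n - 1] is where multiplicity
   at most 4 is needed. *)
Lemma curve_in_partials : (n <= 3)%N ->
  exists al be t, [/\ O 0 al, O 0 be, O n.*2.-1 t & f = al * g1 + be * g2 + t].
Proof.
move=> n3; have kn : kappa n.+1%:R != 0 by rewrite fmorph_eq0.
have Oc : O 0 (kappa n.+1%:R^-1) by apply: (filtC OF).
exists (kappa n.+1%:R^-1 * x), (kappa n.+1%:R^-1 * (x * w)),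
  (kappa n.+1%:R^-1 * (kappa n.+1%:R * f - x * g1 - x * w * g2)); split.
- by apply: (filtZ OF) => //; apply: (filtS OF); apply: (filt_x OF).
- by apply: (filtZ OF) => //; apply: (filtS OF); apply: (filt_xw OF).
- apply: (filtZ OF) => //; apply: (@filt_le _ _ _ _ _ _ OF _ n.+2); first by lia.
  have -> : kappa n.+1%:R * f - x * g1 - x * w * g2 =
     kappa n.+1%:R * (f - form n.+1 P) - x * (g1 - form n a) - x * w * (g2 - form n b).
    have e : kappa n.+1%:R * form n.+1 P = form n.+1 a + form n.+1 ('X * b).
      by rewrite -formD /lead_x subrK formMn rmorph_nat mulr_natl.
    rewrite [in RHS]mulrBr e form_x form_xw; ring.
  apply: (filtB OF); first apply: (filtB OF).
  + by apply: (filtZ OF) => //; apply: (filtC OF).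
  + by rewrite -add1n; apply: (filtM OF) => //; apply: (filt_x OF).
  + by rewrite -add1n; apply: (filtM OF) => //; apply: (filt_xw OF).
- by rewrite fmorphV; move: (kappa _) kn => t t0; field.
Qed.

(** The basis consists of the multiples of [g1] and of [g2] by a basis of O 0 / O (n - 1), which has
    'C(n, 2) elements. It spans because [f] can be traded for the partials and products of order (n
    - 1) + n vanish in the quotient; it is free by [syzygy_filt] at m = n - 1. *)
Lemma jacobian_filt_dim : (0 < n <= 3)%N ->
  quotient_dim kappa jacobian_stalk (O n.*2.-1) ('C(n, 2) + 'C(n, 2)).
Proof.
case/andP=> n0 n3; have kE : n.*2.-1 = (n.-1 + n)%N by lia.
have := filt_dim OF n.-1; rewrite prednK // => -[e [Oe espan]].
have sS := filt_subspace OF.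
have sJ := ideal_subspace OF jacobian_stalk_ideal.
have free := quotient_dim_free (sS 0) (sS n.-1) Oe espan.
apply: (@quotient_dimP _ _ _ _ _ _ (glue (fun i => e i * g1) (fun i => e i * g2))).
- exact: sS.
- have O0 : O 0 0 by apply: subspace0 (sS 0).
  move=> i; rewrite /glue; case: (split i) => j.
    by exists (e j), 0, 0; split => //; ring.
  by exists 0, (e j), 0; split => //; ring.
- move=> _ [al [be [ga [Oal Obe Oga ->]]]].
  have [al' [be' [t [Oal' Obe' Ot ->]]]] := curve_in_partials n3.
  have [c [Oc _]] := espan (al + ga * al') (filtD OF Oal (filtZ OF Oga Oal')).
  have [d [Od _]] := espan (be + ga * be') (filtD OF Obe (filtZ OF Oga Obe')).
  exists (glue (c ord0) (d ord0)); rewrite sum_glue.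
  under eq_bigr do rewrite glue_lshift mulrA.
  under [X in _ - (_ + X)]eq_bigr do rewrite glue_rshift mulrA.
  rewrite -!mulr_suml; set C := \sum_i _ in Oc *; set D := \sum_i _ in Od *.
  have -> : al * g1 + be * g2 + ga * (al' * g1 + be' * g2 + t) - (C * g1 + D * g2) =
    (al + ga * al' - C) * g1 + (be + ga * be' - D) * g2 + ga * t by ring.
  apply: (filtD OF); last exact: (filtZ OF).
  by rewrite kE; apply: (filtD OF); apply: (filtM OF) => //; [exact: filt_g1|exact: filt_g2].
- move=> c; rewrite sum_glue.
  under eq_bigr do rewrite mulrA; under [X in _ + X]eq_bigr do rewrite mulrA.
  rewrite -!mulr_suml => Oc.
  have [] := @syzygy_filt n.-1 _ _ _ _ _ Oc; rewrite ?kE //; try exact: subspace_comb.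
  move=> /(free (fun i => c (lshift _ i))) c1 /(free (fun i => c (rshift _ i))) c2 i.
  by rewrite -(splitK i); case: (split i) => j /=.
Qed.

Theorem ordinary_tjurina_number N : (0 < n <= 3)%N ->
  quotient_dim kappa (O 0) jacobian_stalk N -> N = (n ^ 2)%N.
Proof.
move=> n03 dN; have /andP[n0 n3] := n03.
have sJ := ideal_subspace OF jacobian_stalk_ideal.
have sS := filt_subspace OF.
have Jsub t : jacobian_stalk t -> O 0 t.
  have OS k u : O k u -> O 0 u by apply: (filt_le OF).
  move=> [al [be [ga [Oal Obe Oga ->]]]].
  apply: (filtD OF); first apply: (filtD OF).
  - by apply: (filtZ OF) => //; apply: OS filt_g1.
  - by apply: (filtZ OF) => //; apply: OS filt_g2.
  - by apply: (filtZ OF) => //; apply: (OS n.+1); apply: (filt_lead_mem OF _ lead_f); rewrite sizeP.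
have dS := quotient_dim_add (sS 0) sJ (sS _) Jsub
  (fun t => @filt_sub_jacobian t n0) dN (jacobian_filt_dim n03).
have := quotient_dim_unique (sS 0) (sS _) dS (filt_dim OF _).
rewrite prednK ?double_gt0 //.
by case: n n0 n3 => [|[|[|[|]]]] // _ _; rewrite /binomial /=; lia.
Qed.

End OrdinaryPoint.

(** * Homogeneous polynomials and the blow-up chart at a point *)

(** Reduces the chain rules for the blow-up to constants, variables and the Leibniz rule. *)
Lemma mpoly_ring_ind (n : nat) (R : comNzRingType) (Q : {mpoly R[n]} -> Prop) :
    (forall c, Q c%:MP) -> (forall i, Q 'X_i) ->
    (forall a b, Q a -> Q b -> Q (a + b)) -> (forall a b, Q a -> Q b -> Q (a * b)) ->
  forall a, Q a.
Proof.
move=> QC QX QD QM a; have Q1 : Q 1 by rewrite -mpolyC1.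
have QXn m : Q 'X_[m].
  rewrite mpolyXE_id; apply: (big_ind Q) => // i _.
  by elim: (m i) => [|k IH]; rewrite ?expr0 // exprS; apply: QM.
rewrite [a]mpolyE; apply: (big_ind Q) => //; first by rewrite -mpolyC0.
by move=> m _; rewrite -mul_mpolyC; apply: QM.
Qed.

Section Homogeneous.
Context {n : nat} {R : idomainType}.
Implicit Types (a : {mpoly R[n]}).

Lemma dhomog_mderiv k a i : a \is k.-homog -> a^`M(i) \is k.-1.-homog.
Proof.
move=> /dhomogP ha; apply/dhomogP => m; rewrite mcoeff_msupp mcoeff_deriv => am.
have /ha /= : (m + U_(i))%MM \in msupp a.
  by rewrite mcoeff_msupp; apply: contraNneq am => ->; rewrite mul0rn.
by rewrite mdegD mdeg1 addn1 => <-.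
Qed.

Lemma euler_mpoly k a : a \is k.-homog -> \sum_i 'X_i * a^`M(i) = a *+ k.
Proof.
move=> /dhomogP ha; rewrite [in LHS](mpolyE a) [in RHS](mpolyE a).
under eq_bigr do rewrite raddf_sum /= mulr_sumr.
rewrite exchange_big -sumrMnl /= !big_seq; apply: eq_bigr => m /ha /= <-.
under eq_bigr do rewrite linearZ /= mderivX.
transitivity (\sum_(i < n) (a@_m *: 'X_[m]) *+ m i : {mpoly R[n]}).
  apply: eq_bigr => i _; have [mi|mi] := posnP (m i).
    by rewrite mi mulr0n scale0r scaler0 mulr0.
  rewrite scaler_nat scalerMnr -!scalerAr; congr (_ *: _).
  rewrite mulrnAr -mpolyXD addmC submK //.
  by apply/mnm_lepP => j; rewrite mnm1E; case: eqP => [<-|].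
by rewrite sumrMnr -mdegE.
Qed.

Lemma mderiv_var i j : ('X_j : {mpoly R[n]})^`M(i) = (i == j)%:R.
Proof.
rewrite mderivX mnm1E eq_sym; have [->|_] := eqVneq i j; last by rewrite scale0r.
by rewrite (_ : (U_(j) - U_(j))%MM = 0%MM) ?mpolyX0 ?scale1r //; apply/mnmP => k; rewrite mnmBE subnn mnm0E.
Qed.

Lemma dhomog0_mpolyC a : a \is 0.-homog -> a = (a@_0%MM)%:MP.
Proof.
move=> /dhomogP ha; apply/mpolyP => m; rewrite mcoeffC.
have [->|m0] := eqVneq m 0%MM; first by rewrite mulr1.
rewrite mulr0; apply: memN_msupp_eq0; apply: contra m0 => /ha /= /eqP.
by rewrite mdeg_eq0.
Qed.

End Homogeneous.

Lemma coef0_factor (R : nzRingType) (p : {poly R}) : p`_0 = 0 -> exists r, p = 'X * r.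
Proof.
move=> p0; exists (drop_poly 1 p); rewrite -[LHS](poly_take_drop 1).
have -> : take_poly 1 p = 0.
  by apply/polyP => -[|i]; rewrite coef_take_poly coef0.
by rewrite add0r expr1 commr_polyX.
Qed.

(** In this lemma and the next two, the x's stand for the three dual coordinates, so x0 / x2 and x1
    / x0 are [chart_x] and [chart_w]. *)
Lemma ratio_comp (F : fieldType) (x0 x1 x2 : F) : x0 != 0 ->
  x0 / x2 * (x1 / x0) = x1 / x2.
Proof. by move=> nz0; rewrite mulrC mulrA divfK. Qed.

Lemma ratio_monomial (F : fieldType) (x0 x1 x2 : F) (k i : nat) : x0 != 0 -> x2 != 0 ->
  (i <= k)%N -> (x0 / x2) ^+ k * (x1 / x0) ^+ i = x0 ^+ (k - i) * (x1 ^+ i / x2 ^+ k).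
Proof.
move=> nz0 nz2 ik; rewrite !expr_div_n -{1}(subnK ik) exprD.
move: (expf_neq0 i nz0) (expf_neq0 k nz2); move: (_ ^+ i) (_ ^+ k) => a b na nb.
by field; apply/andP.
Qed.

Lemma ratio_split (F : fieldType) (x0 x1 x2 b c d : F) : x0 != 0 -> x2 != 0 ->
  (x0 * c + x1 * d) / b =
  x0 / x2 * (x2 * c / b) + x0 / x2 * (x1 / x0) * (x2 * d / b).
Proof. by move=> nz0 nz2; rewrite ratio_comp // !mulrA !divfK // -mulrDl. Qed.

Lemma sum_mulmx1 (R : pzRingType) (n : nat) (V : lmodType R) (M N : 'M[R]_n)
    (F : 'I_n -> V) i :
  M *m N = 1%:M -> \sum_j M i j *: (\sum_k N j k *: F k) = F i.
Proof.
move=> MN; under eq_bigr do rewrite scaler_sumr; rewrite exchange_big /=.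
have comb k : \sum_j M i j *: (N j k *: F k) = (M *m N) i k *: F k.
  by rewrite mxE scaler_suml; apply: eq_bigr => j _; rewrite scalerA.
under eq_bigr do rewrite comb MN mxE.
rewrite (bigD1 i) //= eqxx scale1r big1 ?addr0 // => k ki.
by rewrite eq_sym (negPf ki) scale0r.
Qed.

Local Notation i0 := (@ord0 2).
Local Notation i1 := (@Ordinal 3 1 isT).
Local Notation i2 := (@ord_max 2).

Lemma ord3_cases (j : 'I_3) : [\/ j = i0, j = i1 | j = i2].
Proof. by case: j => [[|[|[|//]]] j3]; [apply: Or31|apply: Or32|apply: Or33]; apply/val_inj. Qed.

Lemma sum_ord3 (V : nmodType) (F : 'I_3 -> V) : \sum_i F i = F i0 + F i1 + F i2.
Proof.
rewrite !big_ord_recr big_ord0 /= add0r; congr (F _ + F _ + F _); exact/val_inj.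
Qed.

(** * The local ring at a point, filtered by vanishing order along the exceptional divisor *)

Section Chart.
Context {K : numClosedFieldType} (B : 'M[K]_3) (B_unit : B \in unitmx).
Implicit Types (a b : {mpoly K[3]}).

Local Notation v := (fun i => B i2 i).

(** The basis of linear forms dual to the rows of [B]: [xi i0] and [xi i1] vanish at v, while
    [xi i2] is 1 there and serves as the denominator. *)
Definition dual_coord (j : 'I_3) : {mpoly K[3]} := \sum_i invmx B i j *: 'X_i.
Local Notation xi := dual_coord.

Definition dir_deriv (j : 'I_3) a : {mpoly K[3]} := \sum_i B j i *: a^`M(i).

(* Restriction to the lines through the last row v of [B], in the affine chart
   (t, w) |-> v + t (u1 + w u2) of the blow-up, where u1, u2 are the first rows:
   an element of K[w][t]. *)
Definition blowup_var (i : 'I_3) : {poly {poly K}} :=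
  (B i2 i)%:P%:P + 'X * ((B i0 i)%:P + B i1 i *: 'X)%:P.

Definition blowup a : {poly {poly K}} := mmap (polyC \o polyC) blowup_var a.
Local Notation phi := blowup.

HB.instance Definition _ := GRing.RMorphism.copy blowup (mmap (polyC \o polyC) blowup_var).

Lemma blowupC c : phi c%:MP = c%:P%:P.
Proof. by rewrite /phi mmapC. Qed.

Lemma blowupX i : phi 'X_i = blowup_var i.
Proof. by rewrite /phi mmapX mmap1U. Qed.

Lemma blowupZ c a : phi (c *: a) = c%:P%:P * phi a.
Proof. by rewrite -mul_mpolyC rmorphM /= blowupC. Qed.

Lemma blowup_coef0 a : (phi a)`_0 = (a.@[v])%:P.
Proof.
elim/mpoly_ring_ind: a => [c|i|a b IHa IHb|a b IHa IHb].
- by rewrite blowupC coefC mevalC.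
- by rewrite blowupX mevalXU coefD coefXM coefC addr0.
- by rewrite rmorphD /= coefD IHa IHb mevalD polyCD.
- by rewrite rmorphM /= coef0M IHa IHb mevalM polyCM.
Qed.

(** Chain rule in t: the point v + t (u1 + w u2) moves with velocity u1 + w u2. *)
Lemma deriv_blowup a : (phi a)^`() = phi (dir_deriv i0 a) + 'X%:P * phi (dir_deriv i1 a).
Proof.
have -> : phi (dir_deriv i0 a) + 'X%:P * phi (dir_deriv i1 a) =
    \sum_i phi a^`M(i) * (blowup_var i)^`().
  rewrite /dir_deriv !rmorph_sum mulr_sumr -big_split /=; apply: eq_bigr => i _.
  rewrite !blowupZ /blowup_var derivD derivM derivX !derivC mulr0 addr0 add0r mul1r.
  by rewrite polyCD -mul_polyC polyCM; ring.
elim/mpoly_ring_ind: a => [c|i|a b IHa IHb|a b IHa IHb].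
- by rewrite blowupC derivC big1 // => i _; rewrite mderivC rmorph0 mul0r.
- rewrite blowupX (bigD1 i) //= mderiv_var eqxx rmorph1 mul1r big1 ?addr0 // => j ji.
  by rewrite mderiv_var (negPf ji) rmorph0 mul0r.
- rewrite rmorphD /= derivD IHa IHb -big_split; apply: eq_bigr => i _ /=.
  by rewrite mderivD rmorphD mulrDl.
- rewrite rmorphM /= derivM IHa IHb mulr_suml mulr_sumr -big_split; apply: eq_bigr => i _ /=.
  by rewrite mderivM rmorphD !rmorphM; ring.
Qed.

(** Chain rule in w, where the velocity is t u2. *)
Lemma map_deriv_blowup a : map_poly (@deriv K) (phi a) = 'X * phi (dir_deriv i1 a).
Proof.
have derivE (p q : {poly {poly K}}) : map_poly (@deriv K) (p * q) =
    map_poly (@deriv K) p * q + p * map_poly (@deriv K) q.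
  apply/polyP => i; rewrite coefD coef_map /= !coefM raddf_sum -big_split.
  by apply: eq_bigr => j _ /=; rewrite derivM !coef_map.
have -> : 'X * phi (dir_deriv i1 a) =
    \sum_i phi a^`M(i) * map_poly (@deriv K) (blowup_var i).
  rewrite /dir_deriv !rmorph_sum mulr_sumr; apply: eq_bigr => i _.
  suff -> : map_poly (@deriv K) (blowup_var i) = 'X * (B i1 i)%:P%:P.
    by rewrite /= blowupZ; ring.
  apply/polyP => j; rewrite coef_map /= coefD !coefXM !coefC.
  case: j => [|[|j]] /=; rewrite ?addr0 ?add0r ?derivC ?deriv0 //.
  by rewrite derivD derivC linearZ /= derivX add0r alg_polyC.
elim/mpoly_ring_ind: a => [c|i|a b IHa IHb|a b IHa IHb].
- rewrite blowupC map_polyC /= derivC big1 // => i _; by rewrite mderivC rmorph0 mul0r.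
- rewrite blowupX (bigD1 i) //= mderiv_var eqxx rmorph1 mul1r big1 ?addr0 // => j ji.
  by rewrite mderiv_var (negPf ji) rmorph0 mul0r.
- rewrite !raddfD /= IHa IHb -big_split; apply: eq_bigr => i _ /=.
  by rewrite mderivD rmorphD mulrDl.
- rewrite rmorphM /= derivE IHa IHb mulr_suml mulr_sumr -big_split; apply: eq_bigr => i _ /=.
  by rewrite mderivM rmorphD !rmorphM; ring.
Qed.

Lemma sum_dual_coord i : \sum_j B j i *: xi j = 'X_i.
Proof.
rewrite -[RHS](@sum_mulmx1 _ _ _ B^T (invmx B)^T (fun k => 'X_k) i).
  apply: eq_bigr => j _; rewrite mxE; congr (_ *: _).
  by apply: eq_bigr => k _; rewrite mxE.
by rewrite -trmx_mul mulVmx // trmx1.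
Qed.

Lemma dual_coord_homog j : xi j \is 1.-homog.
Proof. by apply: rpred_sum => i _; apply: rpredZ; rewrite dhomogX /= mdeg1. Qed.

Lemma meval_dual_coord j : (xi j).@[v] = (j == i2)%:R.
Proof.
rewrite /xi rmorph_sum /=; under eq_bigr do rewrite mevalZ mevalXU mulrC.
rewrite (_ : \sum_i _ = (B *m invmx B) i2 j); last by rewrite mxE.
by rewrite mulmxV // mxE eq_sym.
Qed.

Lemma blowup_dual_coord j : phi (xi j) =
  if j == i0 then 'X else if j == i1 then 'X * 'X%:P else 1.
Proof.
pose F k : {poly {poly K}} := if k == i0 then 'X else if k == i1 then 'X * 'X%:P else 1.
have FE i : blowup_var i = \sum_k (B k i)%:P *: F k.
  rewrite sum_ord3 /F /= /blowup_var -!mul_polyC polyCD polyCM; ring.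
pose inj (M : 'M[K]_3) : 'M[{poly K}]_3 := map_mx polyC M.
rewrite /xi rmorph_sum /= -/(F j) -[RHS](@sum_mulmx1 _ _ _ (inj (invmx B))^T (inj B)^T F j).
  apply: eq_bigr => i _; rewrite blowupZ blowupX FE -mul_polyC !mxE; congr (_ * _).
  by apply: eq_bigr => k _; rewrite !mxE.
by rewrite -trmx_mul -map_mxM mulmxV // map_mx1 trmx1.
Qed.

Lemma dir_deriv_homog j k a : a \is k.-homog -> dir_deriv j a \is k.-1.-homog.
Proof. by move=> ha; apply: rpred_sum => i _; apply: rpredZ; apply: dhomog_mderiv. Qed.

Lemma euler_dual k a : a \is k.-homog -> \sum_j xi j * dir_deriv j a = a *+ k.
Proof.
move=> ha; rewrite -(euler_mpoly ha); under [RHS]eq_bigr do rewrite -sum_dual_coord mulr_suml.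
rewrite exchange_big; apply: eq_bigr => j _; rewrite mulr_sumr; apply: eq_bigr => i _ /=.
by rewrite -scalerAr -scalerAl.
Qed.

(** Induction on the degree: Euler's relation writes [a] through its directional derivatives, and
    the one along v is split again. Stating homogeneity for [xi i2 * b] avoids a degree k - 1 at k =
    0 and directly gives the numerators of degree k needed for [filt_gen]. *)
Lemma homog_split k a : a \is k.-homog ->
  exists b c, [/\ xi i2 * b \is k.-homog, xi i2 * c \is k.-homog &
    a = a.@[v] *: xi i2 ^+ k + xi i0 * b + xi i1 * c].
Proof.
elim: k a => [|k IH] a ha.
  exists 0, 0; split; rewrite ?mulr0 ?dhomog0 // !addr0.
  by rewrite {1 2}(dhomog0_mpolyC ha) mevalC expr0 -mul_mpolyC mulr1.
have [b [c [hb hc e]]] := IH _ (dir_deriv_homog i2 ha).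
pose s : K := k.+1%:R^-1; pose d := (dir_deriv i2 a).@[v].
have aE : a = (s * d) *: xi i2 ^+ k.+1 + xi i0 * (s *: (dir_deriv i0 a + xi i2 * b))
   + xi i1 * (s *: (dir_deriv i1 a + xi i2 * c)).
  rewrite [LHS](_ : a = s *: (a *+ k.+1)); last first.
    by rewrite -scaler_nat scalerA mulVf ?scale1r // pnatr_eq0.
  by rewrite -(euler_dual ha) sum_ord3 {1}e -/d -!mul_mpolyC exprS mpolyCM; ring.
have aV : a.@[v] = s * d.
  rewrite {1}aE !mevalD !mevalM mevalZ rmorphXn /= !meval_dual_coord /=.
  by rewrite expr1n mulr1 !mul0r !addr0.
have hmul u : u \is k.-homog -> xi i2 * u \is k.+1.-homog.
  by move=> hu; rewrite -(add1n k); apply: dhomogM (dual_coord_homog i2) hu.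
exists (s *: (dir_deriv i0 a + xi i2 * b)), (s *: (dir_deriv i1 a + xi i2 * c)).
split; last by rewrite aV.
- by apply/hmul/rpredZ/rpredD => //; apply: dir_deriv_homog ha.
- by apply/hmul/rpredZ/rpredD => //; apply: dir_deriv_homog ha.
Qed.

Local Notation L := {fraction {mpoly K[3]}}.
Local Notation kappa := (@tofrac {mpoly K[3]} \o @mpolyC 3 K).

(** Divisibility of the pulled-back numerator by t^k replaces membership in a power of the maximal
    ideal; the denominator is a unit at v. *)
Definition chart_filtration (k : nat) : set L := fun s =>
  exists n a b, [/\ a \is n.-homog, b \is n.-homog, b.@[v] != 0,
    exists r, phi a = 'X ^+ k * r & s = tofrac a / tofrac b].
Local Notation O := chart_filtration.

Lemma chart_filtrationP k m a b r : a \is m.-homog -> b \is m.-homog -> b.@[v] != 0 ->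
  phi a = 'X ^+ k * r -> O k (tofrac a / tofrac b).
Proof. by move=> *; exists m, a, b; split => //; exists r. Qed.

Lemma meval_tofrac_neq0 b : b.@[v] != 0 -> tofrac b != 0.
Proof. by rewrite tofrac_eq0; apply: contra_neq => ->; rewrite meval0. Qed.

Definition chart_x : L := tofrac (xi i0) / tofrac (xi i2).
Definition chart_w : L := tofrac (xi i1) / tofrac (xi i0).

Lemma dual_coord_neq0 j : xi j != 0.
Proof.
apply/eqP => xj0; have := blowup_dual_coord j; rewrite xj0 rmorph0 => /esym/eqP.
case: ifP => _; first by rewrite polyX_eq0.
by case: ifP => _; rewrite ?oner_eq0 // mulf_eq0 polyX_eq0 polyC_eq0 polyX_eq0.
Qed.

Lemma meval_xi2_exp k : (xi i2 ^+ k).@[v] = 1.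
Proof. by rewrite rmorphXn /= meval_dual_coord expr1n. Qed.

Lemma blowup_xi2_exp k : phi (xi i2 ^+ k) = 1.
Proof. by rewrite rmorphXn /= blowup_dual_coord expr1n. Qed.

Lemma dual_exp_homog j k : xi j ^+ k \is k.-homog.
Proof. by have := dhomogMn k (dual_coord_homog j); rewrite mul1n. Qed.

Definition homog_form (k : nat) (q : {poly K}) : {mpoly K[3]} :=
  \sum_(i < k.+1) q`_i *: (xi i0 ^+ (k - i) * xi i1 ^+ i).

Lemma homog_form_homog k q : homog_form k q \is k.-homog.
Proof.
apply: rpred_sum => i _; apply: rpredZ.
have := dhomogM (dual_exp_homog i0 (k - i)) (dual_exp_homog i1 i).
by rewrite subnK // -ltnS.
Qed.

Lemma blowup_homog_form k (q : {poly K}) : (size q <= k.+1)%N -> phi (homog_form k q) = 'X ^+ k * q%:P.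
Proof.
move=> sq; rewrite /homog_form rmorph_sum /= {2}(poly_sum_wide sq).
rewrite rmorph_sum mulr_sumr; apply: eq_bigr => i _ /=.
rewrite blowupZ rmorphM !rmorphXn /= !blowup_dual_coord /= exprMn.
have -> : 'X ^+ k = 'X ^+ (k - i) * 'X ^+ i :> {poly {poly K}}.
  by rewrite -exprD subnK // -ltnS.
by rewrite -mul_polyC polyCM rmorphXn /=; ring.
Qed.

Lemma chart_formE k (q : {poly K}) : (size q <= k.+1)%N ->
  form kappa chart_x chart_w k q = tofrac (homog_form k q) / tofrac (xi i2 ^+ k).
Proof.
move=> sq; rewrite (form_polyE _ _ _ sq) /homog_form rmorph_sum mulr_suml.
apply: eq_bigr => i _; rewrite /form map_polyXn hornerXn /= -mul_mpolyC !rmorphM -!mulrA.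
congr (_ * _); rewrite !rmorphXn /=; apply: ratio_monomial; rewrite ?tofrac_eq0 ?dual_coord_neq0 //.
by rewrite -ltnS.
Qed.

Lemma chart_local_filtration : local_filtration kappa O chart_x chart_w.
Proof.
have v2 := meval_dual_coord i2; rewrite eqxx in v2.
have v2n : (xi i2).@[v] != 0 by rewrite v2 oner_eq0.
split.
- move=> c; suff : O 0 (tofrac c%:MP / tofrac 1) by rewrite rmorph1 divr1.
  apply: (@chart_filtrationP _ 0 _ _ (phi c%:MP)); rewrite ?expr0 ?mul1r ?meval1 ?oner_eq0 //.
    by rewrite -[c%:MP]mulr1 mul_mpolyC; apply: rpredZ; apply: dhomog1.
  exact: dhomog1.
- move=> k _ _ [m [a [b [ha hb b0 [r er] ->]]]] [m' [a' [b' [ha' hb' b0' [r' er'] ->]]]].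
  rewrite addf_div ?meval_tofrac_neq0 // -!rmorphM -rmorphD.
  apply: (@chart_filtrationP _ (m + m') _ _ (r * phi b' + r' * phi b)).
  + by apply: rpredD; [apply: dhomogM|rewrite mulrC; apply: dhomogM].
  + exact: dhomogM.
  + by rewrite mevalM mulf_neq0.
  + by rewrite rmorphD !rmorphM /= er er'; ring.
- move=> j k _ _ [m [a [b [ha hb b0 [r er] ->]]]] [m' [a' [b' [ha' hb' b0' [r' er'] ->]]]].
  rewrite mulf_div -!rmorphM; apply: (@chart_filtrationP _ (m + m') _ _ (r * r')).
  + exact: dhomogM.
  + exact: dhomogM.
  + by rewrite mevalM mulf_neq0.
  + by rewrite rmorphM /= er er' exprD; ring.
- move=> k _ [m [a [b [ha hb b0 [r er] ->]]]].
  by apply: (@chart_filtrationP _ m _ _ ('X * r)) => //; rewrite er exprSr mulrA.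
(* Here a(v) = 0, so the inverse b / (b - a) has a denominator that does not vanish at v. *)
- move=> _ [m [a [b [ha hb b0 [r er] ->]]]].
  have av : a.@[v] = 0.
    by apply: polyC_inj; rewrite -blowup_coef0 er expr1 coefXM.
  rewrite -{1}(divff (meval_tofrac_neq0 b0)) -mulrBl invf_div -rmorphB.
  apply: (@chart_filtrationP _ m _ _ (phi b)); rewrite ?expr0 ?mul1r //.
    exact: rpredB.
  by rewrite mevalB av subr0.
- apply: (@chart_filtrationP _ 1 _ _ 1); rewrite ?dual_coord_homog //.
  by rewrite blowup_dual_coord mulr1.
- have -> : chart_x * chart_w = tofrac (xi i1) / tofrac (xi i2).
    by apply: ratio_comp; rewrite tofrac_eq0 dual_coord_neq0.
  apply: (@chart_filtrationP _ 1 _ _ 'X%:P); rewrite ?dual_coord_homog //.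
  by rewrite blowup_dual_coord.
(* After pull-back both sides carry t^k; cancelling it and setting t = 0 leaves q * b(v) = 0. *)
- move=> k q sq; rewrite chart_formE // => -[m [a [b [ha hb b0 [r er] e]]]].
  have {}e : homog_form k q * b = a * xi i2 ^+ k.
    apply/eqP; rewrite -tofrac_eq !rmorphM /=; apply/eqP.
    move/eqP: e; rewrite eqr_div ?meval_tofrac_neq0 ?meval_xi2_exp ?oner_eq0 //.
    by move/eqP.
  have /(congr1 phi) := e; rewrite !rmorphM /= blowup_homog_form // er blowup_xi2_exp mulr1.
  rewrite exprSr -!mulrA => /(mulfI (monic_neq0 (monicXn _ k)))/polyP/(_ 0%N).
  rewrite coefCM coefXM blowup_coef0 => /eqP; rewrite mulf_eq0 polyC_eq0 (negPf b0) orbF.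
  by move/eqP.
(* The residue of a fraction is its value at v. *)
- move=> _ [m [a [b [ha hb b0 _ ->]]]]; exists (a.@[v] / b.@[v]).
  have hc : a - (a.@[v] / b.@[v]) *: b \is m.-homog by apply: rpredB => //; apply: rpredZ.
  have -> : tofrac a / tofrac b - kappa (a.@[v] / b.@[v]) =
      tofrac (a - (a.@[v] / b.@[v]) *: b) / tofrac b.
    move: (a.@[v] / b.@[v]) => c.
    by rewrite -mul_mpolyC rmorphB [in RHS]rmorphM mulrBl mulfK ?meval_tofrac_neq0.
  have [|r er] := @coef0_factor _ (phi (a - (a.@[v] / b.@[v]) *: b)).
    by rewrite blowup_coef0 mevalB mevalZ divfK // subrr.
  by apply: (@chart_filtrationP _ m _ _ r); rewrite ?expr1.
- move=> _ [m [a [b [ha hb b0 [r er] ->]]]].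
  have [c [d [hc hd e]]] := homog_split ha.
  have av : a.@[v] = 0.
    by apply: polyC_inj; rewrite -blowup_coef0 er expr1 coefXM.
  exists (tofrac (xi i2 * c) / tofrac b), (tofrac (xi i2 * d) / tofrac b); split.
  + by apply: (@chart_filtrationP _ m _ _ (phi (xi i2 * c))); rewrite ?expr0 ?mul1r.
  + by apply: (@chart_filtrationP _ m _ _ (phi (xi i2 * d))); rewrite ?expr0 ?mul1r.
  + rewrite {1}e av scale0r add0r rmorphD !rmorphM /=.
    by apply: ratio_split; rewrite tofrac_eq0 dual_coord_neq0.
Qed.

End Chart.

(** * The stalk of the Jacobian ideal *)

Lemma ratio_euler (F : fieldType) (x0 x1 x2 a b c d s : F) (k : nat) :
    x0 != 0 -> x2 != 0 -> x0 * a + x1 * b + x2 * c = s * d ->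
  c / x2 ^+ k = - (x0 / x2) * (a / x2 ^+ k) + - (x0 / x2 * (x1 / x0)) * (b / x2 ^+ k)
    + s * (d / x2 ^+ k.+1).
Proof.
move=> nz0 nz2 e; rewrite [s * (d / _)]mulrA -e exprS.
by move: (expf_neq0 k nz2); move: (_ ^+ k) => t nzt; field; rewrite nz2 nz0 nzt.
Qed.

Lemma pihomogM_dhomog (n : nat) (R : idomainType) (N d : nat) (c G : {mpoly R[n]}) :
  G \is d.-homog ->
  pihomog mdeg N (c * G) = if (d <= N)%N then pihomog mdeg (N - d) c * G else 0.
Proof.
move=> hG; rewrite [c]mpolyE mulr_suml !raddf_sum /=.
have -> : (if (d <= N)%N then (\sum_(m <- msupp c) pihomog mdeg (N - d) (c@_m *: 'X_[m])) * G else 0)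
  = \sum_(m <- msupp c) if (d <= N)%N then pihomog mdeg (N - d) (c@_m *: 'X_[m]) * G else 0.
  by case: ifP => _; [rewrite mulr_suml|rewrite big1].
apply: eq_bigr => m _.
have hm : c@_m *: 'X_[m] * G \is (mdeg m + d).-homog.
  by apply: dhomogM => //; apply: rpredZ; rewrite dhomogX.
rewrite linearZ /= pihomogX; case: leqP => [dN|Nd]; last first.
  by rewrite (pihomog_ne0 _ hm) //; move: Nd; clear; lia.
case: ifPn => /= [/eqP e|ne].
  by rewrite pihomog_dE //; move: hm; rewrite e subnK.
rewrite scaler0 mul0r (pihomog_ne0 _ hm) //.
by apply: contra ne => /eqP <-; rewrite addnK.
Qed.

Lemma lead_x_comb (R : comNzRingType) (t x y p p' q r s s' : R) (n : nat) :
    s = p + x * q ->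
  t *+ n * s + x * t * s' - y * (t * (p' + x * r)) =
  t * (p *+ n - y * p' + x * (q *+ n + s' - y * r)).
Proof. by move=> ->; ring. Qed.

Section CurveGerm.
Context {K : numClosedFieldType} (B : 'M[K]_3) (B_unit : B \in unitmx).
Context (p : proj_plane K) (Bp : forall i, B i2 i = hcoord p i).
Local Notation v := (fun i => B i2 i).
Local Notation xi := (dual_coord B).
Local Notation phi := (blowup B).
Local Notation O := (chart_filtration B).
Local Notation x := (chart_x B).
Local Notation w := (chart_w B).
Local Notation kappa := (@tofrac {mpoly K[3]} \o @mpolyC 3 K).
Let OF := chart_local_filtration B_unit.

(** Leading forms are read off the blow-up: [xi i2] pulls back to 1, so subtracting the form removes
    exactly the t^k term. *)
Lemma chart_lead k m (a : {mpoly K[3]}) (q : {poly K}) r :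
    a \is m.-homog -> (size q <= k.+1)%N -> phi a = 'X ^+ k * (q%:P + 'X * r) ->
  O k.+1 (tofrac a / tofrac (xi i2 ^+ m) - form kappa x w k q).
Proof.
move=> ha sq ea; rewrite chart_formE // -mulNr -rmorphN.
have v2 j : (xi i2 ^+ j).@[v] != 0 by rewrite meval_xi2_exp ?oner_eq0.
have nz j : tofrac (xi i2 ^+ j) != 0 by apply: (@meval_tofrac_neq0 _ B).
rewrite addf_div // -!rmorphM -rmorphD.
have hx j := dual_exp_homog B i2 j; have hh := homog_form_homog B k q.
apply: (@chart_filtrationP _ _ _ (m + k) _ _ r).
- apply: rpredD; first exact: dhomogM.
  by rewrite addnC; apply: dhomogM => //; rewrite rpredN.
- exact: dhomogM.
- by rewrite mevalM mulf_neq0.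
- rewrite rmorphD !rmorphM rmorphN /= !blowup_xi2_exp // blowup_homog_form // ea exprSr; ring.
Qed.

Lemma stalk_setTE : stalk setT p = O 0.
Proof.
apply/seteqP; split=> s [m [a [b]]].
  move=> [ha hb _ bp ->]; apply: (@chart_filtrationP _ _ _ m _ _ (phi a)) => //.
    by rewrite (meval_eq _ Bp).
  by rewrite mul1r.
move=> [ha hb b0 _ ->]; exists m, a, b; split => //.
by rewrite /lies_on -(meval_eq _ Bp).
Qed.

Lemma stalk_ideal (I : set {mpoly K[3]}) : I 0 ->
    (forall a b, I a -> I b -> I (a + b)) -> (forall c a, I a -> I (c * a)) ->
  is_ideal O (stalk I p).
Proof.
move=> I0 ID IM; split.
- exists 0%N, 0, 1; split; rewrite ?dhomog0 ?dhomog1 // ?rmorph0 ?mul0r //.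
  by rewrite /lies_on meval1 oner_eq0.
- move=> _ _ [m [a [b [ha hb Ia bp ->]]]] [m' [a' [b' [ha' hb' Ia' bp' ->]]]].
  have nz c : ~~ lies_on c p -> tofrac c != 0.
    by rewrite tofrac_eq0; apply: contraNneq => ->; rewrite /lies_on meval0.
  rewrite addf_div ?nz // -!rmorphM -rmorphD.
  exists (m + m')%N, (a * b' + a' * b), (b * b'); split => //.
  + by apply: rpredD; [apply: dhomogM|rewrite mulrC; apply: dhomogM].
  + exact: dhomogM.
  + by apply: ID; rewrite mulrC; apply: IM.
  + by rewrite /lies_on mevalM mulf_eq0 negb_or bp.
- move=> _ _ [m [a [b [ha hb b0 _ ->]]]] [m' [a' [b' [ha' hb' Ia' bp' ->]]]].
  rewrite mulf_div -!rmorphM.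
  exists (m + m')%N, (a * a'), (b * b'); split => //.
  + exact: dhomogM.
  + exact: dhomogM.
  + exact: IM.
  + by rewrite /lies_on mevalM mulf_eq0 negb_or -(meval_eq _ Bp) b0.
Qed.

Lemma jacobian_ideal0 (F : {mpoly K[3]}) : jacobian_ideal F 0.
Proof. by exists (fun=> 0); rewrite big1 // => i _; rewrite mul0r. Qed.

Lemma jacobian_idealD (F a b : {mpoly K[3]}) :
  jacobian_ideal F a -> jacobian_ideal F b -> jacobian_ideal F (a + b).
Proof.
move=> [c ->] [d ->]; exists (fun i => c i + d i); rewrite -big_split.
by apply: eq_bigr => i _; rewrite mulrDl.
Qed.

Lemma jacobian_idealM (F c a : {mpoly K[3]}) :
  jacobian_ideal F a -> jacobian_ideal F (c * a).
Proof.
move=> [d ->]; exists (fun i => c * d i); rewrite mulr_sumr.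
by apply: eq_bigr => i _; rewrite mulrA.
Qed.

Lemma jacobian_ideal_mderiv (F : {mpoly K[3]}) i : jacobian_ideal F F^`M(i).
Proof.
exists (fun j => (j == i)%:R).
rewrite (bigD1 i) //= eqxx mul1r big1 ?addr0 // => j /negPf->.
by rewrite mul0r.
Qed.

(** By Euler's relation the partials already generate [F], which is why the Jacobian ideal cuts out
    the Tjurina algebra and not the Milnor algebra. *)
Lemma jacobian_ideal_homog (F : {mpoly K[3]}) k : F \is k.+1.-homog -> jacobian_ideal F F.
Proof.
move=> hF; exists (fun i => k.+1%:R^-1 *: 'X_i); under eq_bigr do rewrite -scalerAl.
rewrite -scaler_sumr (euler_mpoly hF) -scaler_nat scalerA mulVf ?scale1r //.
by rewrite pnatr_eq0.
Qed.

Context (F : {mpoly K[3]}) (e : nat) (hF : F \is e.+1.-homog).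
Let g j := tofrac (dir_deriv B j F) / tofrac (xi i2 ^+ e).
Let f := tofrac F / tofrac (xi i2 ^+ e.+1).

Lemma mderiv_dir_deriv i (a : {mpoly K[3]}) :
  a^`M(i) = \sum_j invmx B i j *: dir_deriv B j a.
Proof.
by rewrite (@sum_mulmx1 _ _ _ (invmx B) B (fun k => a^`M(k))) ?mulVmx.
Qed.

(** The coefficients in a member of the ideal are arbitrary; taking components of degree N makes
    them homogeneous. Homogeneity is stated after multiplication by [xi i2 ^+ e], which also covers
    N < e, where they are zero. *)
Lemma homog_jacobian_ideal N a : a \is N.-homog -> jacobian_ideal F a ->
  exists c : 'I_3 -> {mpoly K[3]},
    [/\ forall j, c j * xi i2 ^+ e \is N.-homog & a = \sum_j c j * dir_deriv B j F].
Proof.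
move=> ha [c ac].
have hd i : F^`M(i) \is e.-homog by have := dhomog_mderiv i hF.
have aE : a = \sum_i (if (e <= N)%N then pihomog mdeg (N - e) (c i) * F^`M(i) else 0).
  rewrite -[LHS](pihomog_dE ha) ac raddf_sum; apply: eq_bigr => i _ /=.
  by rewrite (pihomogM_dhomog _ _ (hd i)).
pose d i := if (e <= N)%N then pihomog mdeg (N - e) (c i) else 0.
exists (fun j => \sum_i invmx B i j *: d i); split.
  move=> j; rewrite mulr_suml; apply: rpred_sum => i _; rewrite -scalerAl; apply: rpredZ.
  rewrite /d; case: ifP => eN; last by rewrite mul0r dhomog0.
  have := dhomogM (pihomogP mdeg (N - e) (c i)) (dual_exp_homog B i2 e).
  by rewrite subnK.
under eq_bigr do rewrite mulr_suml.
rewrite exchange_big aE; apply: eq_bigr => i _ /=.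
rewrite -[LHS]/(if (e <= N)%N then _ else 0).
have -> : (if (e <= N)%N then pihomog mdeg (N - e) (c i) * F^`M(i) else 0) = d i * F^`M(i).
  by rewrite /d; case: ifP; rewrite ?mul0r.
rewrite mderiv_dir_deriv mulr_sumr; apply: eq_bigr => j _.
by rewrite -scalerAr -scalerAl.
Qed.

(** The homogeneous ideal has three derivatives as generators, the local one has two and the
    equation: divided by powers of [xi i2], Euler's relation exchanges the derivative along v for
    [f]. *)
Lemma stalk_jacobianE : stalk (jacobian_ideal F) p = jacobian_stalk O (g i0) (g i1) f.
Proof.
have iJ := @jacobian_stalk_ideal _ _ _ _ _ _ OF (g i0) (g i1) f.
have iS := stalk_ideal (jacobian_ideal0 F) (@jacobian_idealD F) (@jacobian_idealM F).
have z2 k : tofrac (xi i2 ^+ k) != 0.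
  by apply: (@meval_tofrac_neq0 _ B); rewrite meval_xi2_exp ?oner_eq0.
have z2p k : ~~ lies_on (xi i2 ^+ k) p.
  by rewrite /lies_on -(meval_eq _ Bp) meval_xi2_exp ?oner_eq0.
have O0 : O 0 0 by apply: subspace0 (filt_subspace OF 0).
have O1 : O 0 1 by rewrite -(rmorph1 kappa); apply: (filtC OF).
apply/seteqP; split=> s.
  move=> [N [a [b [ha hb Ja bp ->]]]].
  have [c [hc ->]] := homog_jacobian_ideal ha Ja.
  have J0 : jacobian_stalk O (g i0) (g i1) f (g i0) by exists 1, 0, 0; split => //; ring.
  have J1 : jacobian_stalk O (g i0) (g i1) f (g i1) by exists 0, 1, 0; split => //; ring.
  have J2 : jacobian_stalk O (g i0) (g i1) f (g i2).
    exists (- x), (- (x * w)), (kappa e.+1%:R); split.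
    - by apply: (subspaceN (filt_subspace OF _)); apply: (filtS OF); apply: (filt_x OF).
    - by apply: (subspaceN (filt_subspace OF _)); apply: (filtS OF); apply: (filt_xw OF).
    - exact: (filtC OF).
    - have := euler_dual B_unit hF; rewrite sum_ord3 => /(congr1 (@tofrac _)).
      rewrite !rmorphD rmorphMn !rmorphM /= -mulr_natl -(rmorph_nat kappa) /g /f !rmorphXn /=.
      by apply: ratio_euler; rewrite tofrac_eq0 dual_coord_neq0.
  have Jg j : jacobian_stalk O (g i0) (g i1) f (g j).
    by case: (ord3_cases j) => ->.
  rewrite rmorph_sum mulr_suml; apply: (subspace_sum _ (ideal_subspace OF iJ)) => j _.
  rewrite (_ : _ / _ = (tofrac (c j * xi i2 ^+ e) / tofrac b) * g j).
    apply: (idealM iJ) => //; rewrite -stalk_setTE.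
    by exists N, (c j * xi i2 ^+ e), b; split.
  rewrite /g !rmorphM /= mulrACA -!mulrA; congr (_ * _).
  by rewrite mulrCA mulrA mulrCA mulfK // mulrC.
have Sg j : stalk (jacobian_ideal F) p (g j).
  exists e, (dir_deriv B j F), (xi i2 ^+ e); split => //.
  - exact: dir_deriv_homog hF.
  - exact: dual_exp_homog.
  - by exists (fun i => (B j i)%:MP); apply: eq_bigr => i _; rewrite mul_mpolyC.
have Sf : stalk (jacobian_ideal F) p f.
  exists e.+1, F, (xi i2 ^+ e.+1); split => //.
  - exact: dual_exp_homog.
  - exact: jacobian_ideal_homog hF.
move=> [al [be [ga [? ? ? ->]]]].
by apply: (idealD iS); [apply: (idealD iS)|]; apply: (idealM iS).
Qed.

(** The w-derivative of the expansion gives the derivative along [row i1 B]; subtracting w times it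
    from the t-derivative gives the other, with leading form (n + 1) P - w P'. *)
Lemma blowup_partials n (P : {poly K}) r : phi F = 'X ^+ n.+1 * (P%:P + 'X * r) ->
  exists r0 r1, phi (dir_deriv B i0 F) = 'X ^+ n * ((lead_x n P)%:P + 'X * r0) /\
    phi (dir_deriv B i1 F) = 'X ^+ n * (P^`()%:P + 'X * r1).
Proof.
move=> eF.
have e1 : phi (dir_deriv B i1 F) = 'X ^+ n * (P^`()%:P + 'X * map_poly (@deriv K) r).
  apply: (mulfI (monic_neq0 (monicX _))); rewrite -map_deriv_blowup eF mulrA -exprS.
  apply/polyP => j; rewrite coef_map /= !coefXnM; case: ifP => _; first exact: deriv0.
  rewrite !coefD !coefXM !coefC derivD; congr (_ + _); case: (_ - _)%N => [|k] /=;
    by rewrite ?deriv0 // coef_map.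
move: (map_poly _ r) e1 => r' e1.
have [s es] : exists s, s = P%:P + 'X * r by eexists.
rewrite -es in eF; pose s' := s^`(); exists (r *+ n.+1 + s' - 'X%:P * r'), r'; split=> //.
have := deriv_blowup B F; rewrite e1 => /eqP; rewrite -subr_eq => /eqP <-.
rewrite eF derivM derivXn -/s' /= exprS.
have -> : (lead_x n P)%:P = P%:P *+ n.+1 - 'X%:P * P^`()%:P :> {poly {poly K}}.
  by rewrite /lead_x polyCB polyCM polyCMn.
exact: lead_x_comb.
Qed.

Theorem tjurina_of_leading_form (n N : nat) (P : {poly K}) r :
    phi F = 'X ^+ n.+1 * (P%:P + 'X * r) -> size P = n.+2 -> coprimep P P^`() ->
    (0 < n <= 3)%N -> local_length (jacobian_ideal F) p N ->
  N = (n ^ 2)%N.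
Proof.
move=> eF sP cP n03 lenN; have [r0 [r1 [e0 e1]]] := blowup_partials eF.
have char_n : n.+1%:R != 0 :> K by rewrite pnatr_eq0.
apply: (@ordinary_tjurina_number _ _ kappa _ _ _ OF n P sP cP char_n (g i0) (g i1) f) => //.
- by apply: chart_lead eF => //; rewrite sP.
- apply: chart_lead e0; first exact: dir_deriv_homog hF.
  exact: size_lead_x.
- apply: chart_lead e1; first exact: dir_deriv_homog hF.
  by rewrite (size_lead_y sP char_n).
- by rewrite -stalk_jacobianE -stalk_setTE.
Qed.

End CurveGerm.

(** * Intersections of lines and conics *)

Section LinearForms.
Context {K : fieldType}.
Implicit Types (c l : 'I_3 -> K) (y u : 'rV[K]_3).

Definition dot c y : K := \sum_i c i * y ord0 i.

Lemma dotD c y u : dot c (y + u) = dot c y + dot c u.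
Proof. by rewrite /dot -big_split; apply: eq_bigr => i _; rewrite mxE mulrDr. Qed.

Lemma dotZ c a y : dot c (a *: y) = a * dot c y.
Proof. by rewrite /dot mulr_sumr; apply: eq_bigr => i _; rewrite mxE mulrCA. Qed.

Lemma dot_delta c i : dot c (delta_mx ord0 i) = c i.
Proof.
rewrite /dot (bigD1 i) //= mxE !eqxx mulr1 big1 ?addr0 // => j ji.
by rewrite mxE (negPf ji) andbF mulr0.
Qed.

(** With z chosen so that [dot c z] is 1, subtracting a multiple of z moves any vector into the
    kernel of c; hence l is [dot l z] times c, and this factor is not 0. *)
Lemma dot_ker_eq c l : (exists i, c i != 0) -> (exists i, l i != 0) ->
  (forall y, dot c y = 0 -> dot l y = 0) -> forall y, dot c y = 0 <-> dot l y = 0.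
Proof.
move=> [k ck] [m lm] cl y; split; first exact: cl.
pose z := (c k)^-1 *: delta_mx ord0 k : 'rV[K]_3.
have lE y' : dot l y' = dot c y' * dot l z.
  have /cl : dot c (y' + (- dot c y') *: z) = 0.
    by rewrite dotD !dotZ dot_delta mulVf // mulr1 subrr.
  by rewrite dotD dotZ mulNr => /eqP; rewrite subr_eq0 => /eqP.
rewrite lE => /eqP; rewrite mulf_eq0 => /orP[/eqP //|/eqP lz].
by case/eqP: lm; rewrite -dot_delta lE lz mulr0.
Qed.

Lemma dot_ker_basis c : (exists i, c i != 0) -> exists u0 u1 : 'rV[K]_3,
  (forall a b, a *: u0 + b *: u1 = 0 -> a = 0 /\ b = 0) /\
  forall y, dot c y = 0 <-> exists a b, y = a *: u0 + b *: u1.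
Proof.
move=> [k ck]; pose C : 'cV[K]_3 := \col_i c i.
have dotE y : dot c y = (y *m C) ord0 ord0.
  by rewrite mxE; apply: eq_bigr => i _; rewrite mxE mulrC.
have rC : \rank C = 1%N.
  apply/eqP; rewrite eqn_leq rank_leq_col lt0n mxrank_eq0.
  by apply: contraNneq ck => /matrixP/(_ k ord0); rewrite !mxE => ->.
have rk : \rank (kermx C) = 2%N by rewrite mxrank_ker rC.
have [R [Rfree RE]] : exists R : 'M[K]_(2, 3), row_free R /\ (R :=: kermx C)%MS.
  move: (row_base _) (row_base_free (kermx C)) (eq_row_base (kermx C)).
  by rewrite rk => R ? ?; exists R.
have comb (a b : K) : (\row_(i < 2) (if i == ord0 then a else b)) *m R =
    a *: row ord0 R + b *: row ord_max R.
  rewrite mulmx_sum_row !big_ord_recl big_ord0 !mxE addr0; congr (_ + _ *: row _ R).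
  exact/val_inj.
exists (row ord0 R), (row ord_max R); split=> [a b|y].
  rewrite -comb -(mul0mx _ R) => /(row_free_inj Rfree)/rowP e.
  by have := e ord0; have := e ord_max; rewrite !mxE.
rewrite dotE; split=> [yC|[a [b ->]]].
  have : (y <= R)%MS.
    rewrite RE; apply/sub_kermxP/matrixP => i j; rewrite !ord1 yC mxE //.
  case/submxP => x ->; exists (x ord0 ord0), (x ord0 ord_max); rewrite -comb; congr (_ *m _).
  apply/rowP => i; rewrite mxE; case: eqP => [->//|/eqP i0]; congr (x _ _).
  by apply/val_inj; case: i i0 => [[|[|]]].
suff -> : (a *: row ord0 R + b *: row ord_max R) *m C = 0 by rewrite mxE.
by apply/sub_kermxP; rewrite -RE -comb submxMl.
Qed.

Lemma dot_ker_basis_at c y : (exists i, c i != 0) -> y != 0 -> dot c y = 0 ->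
  exists u : 'rV[K]_3,
  (forall a b, a *: y + b *: u = 0 -> a = 0 /\ b = 0) /\
  forall z, dot c z = 0 <-> exists a b, z = a *: y + b *: u.
Proof.
move=> /dot_ker_basis[u0 [u1 [free span]]] y0 /span[a [b ey]].
have [a0|a0] := eqVneq a 0.
  have b0 : b != 0 by apply: contraNneq y0 => b0; rewrite ey a0 b0 !scale0r addr0.
  exists u0; rewrite ey a0 scale0r add0r; split=> [s t|z].
    rewrite scalerA addrC => /free[-> /eqP].
    by rewrite mulf_eq0 (negPf b0) orbF => /eqP.
  rewrite span; split=> [[s [t ->]]|[s [t ->]]].
    by exists (t / b), s; rewrite scalerA divfK // addrC.
  by exists t, (s * b); rewrite scalerA addrC.
exists u1; rewrite ey; split=> [s t|z].
  rewrite scalerDr !scalerA -addrA -scalerDl => /free[/eqP].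
  by rewrite mulf_eq0 (negPf a0) orbF => /eqP-> ; rewrite mul0r add0r.
rewrite span; split=> [[s [t ->]]|[s [t ->]]].
  exists (s / a), (t - s / a * b).
  by rewrite scalerDr !scalerA divfK // -addrA -scalerDl [_ * b + _]addrC subrK.
by exists (s * a), (s * b + t); rewrite scalerDr !scalerA scalerDl addrA.
Qed.

End LinearForms.

Section ProjectivePoints.
Context {K : numClosedFieldType}.
Implicit Types (F G : {mpoly K[3]}) (p q : proj_plane K) (y u : 'rV[K]_3).

Definition hvec p : 'rV[K]_3 := vpick (point_space p).

Lemma hvec_neq0 p : hvec p != 0.
Proof.
by rewrite vpick0 -dimv_eq0; case: p => V /= /eqP->.
Qed.

Lemma point_spaceE p : point_space p = <[hvec p]>%VS.
Proof.
apply/esym/eqP; rewrite eqEdim dim_vline hvec_neq0 -memvE memv_pick /=.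
by case: p => V /= /eqP->.
Qed.

Lemma hvec_eq p q a : hvec p = a *: hvec q -> p = q.
Proof.
move=> e; apply/val_inj; rewrite /= !point_spaceE.
have a0 : a != 0.
  by apply: contraNneq (hvec_neq0 p) => a0; rewrite e a0 scale0r.
apply/eqP; rewrite eqEdim !dim_vline !hvec_neq0 andbT -memvE e.
by rewrite memvZ // memv_line.
Qed.

Lemma exists_point y : y != 0 -> exists p a, a != 0 /\ hvec p = a *: y.
Proof.
move=> y0; have dy : \dim <[y]> == 1%N by rewrite dim_vline y0.
exists (ProjPoint dy); have := memv_pick <[y]>%VS => /vlineP[a ea].
exists a; split => //; apply: contraNneq (hvec_neq0 (ProjPoint dy)) => a0.
by rewrite /hvec /= ea a0 scale0r.
Qed.

Lemma meval_homogZ n F a y : F \is n.-homog ->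
  F.@[(a *: y) ord0] = a ^+ n * F.@[y ord0].
Proof.
move=> /dhomogP hF; rewrite !mevalE mulr_sumr !big_seq; apply: eq_bigr => m /hF /= <-.
rewrite mulrCA; congr (_ * _); rewrite mdegE -prodrXr -big_split.
by apply: eq_bigr => i _; rewrite mxE exprMn.
Qed.

Lemma lies_onE n F p y a : F \is n.-homog -> a != 0 -> hvec p = a *: y ->
  lies_on F p = (F.@[y ord0] == 0).
Proof.
move=> hF a0 e; rewrite /lies_on -[F.@[_]]/(F.@[hvec p ord0]) e (meval_homogZ _ _ hF).
by rewrite mulf_eq0 expf_eq0 (negPf a0) andbF.
Qed.

Definition gradient F y : 'I_3 -> K := fun i => F^`M(i).@[y ord0].

Lemma tangent_lineE F p q : tangent_line F p q <-> dot (gradient F (hvec p)) (hvec q) = 0.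
Proof. by []. Qed.

Lemma euler_meval n F y : F \is n.-homog -> dot (gradient F y) y = F.@[y ord0] *+ n.
Proof.
move=> hF; rewrite -rmorphMn -(euler_mpoly hF) rmorph_sum.
by apply: eq_bigr => i _ /=; rewrite mevalM mevalXU mulrC.
Qed.

Lemma line_gradient F y u : F \is 1.-homog -> gradient F y = gradient F u.
Proof.
move=> hF; apply/funext => i; rewrite /gradient.
by rewrite (dhomog0_mpolyC (dhomog_mderiv i hF)) !mevalC.
Qed.

Lemma line_meval F y u : F \is 1.-homog -> F.@[y ord0] = dot (gradient F u) y.
Proof. by move=> hF; rewrite (line_gradient u y hF) (euler_meval _ hF). Qed.

Lemma line_gradient_neq0 F y : is_line F -> exists i, gradient F y i != 0.
Proof.
move=> [hF F0]; apply: contrapT => noti; case/eqP: F0.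
rewrite -[F]mulr1n -(euler_mpoly hF) big1 // => i _.
rewrite (dhomog0_mpolyC (dhomog_mderiv i hF)).
have [/eqP|gi] := eqVneq (gradient F y i) 0; last by case: noti; exists i.
rewrite /gradient {1}(dhomog0_mpolyC (dhomog_mderiv i hF)) mevalC => /eqP->.
by rewrite mpolyC0 mulr0.
Qed.

(** Euler's relation applied twice writes 2 G as the quadratic form of its constant, symmetric
    Hessian, so the expansion is polarization. *)
Lemma quadric_meval G a b y u : G \is 2.-homog ->
  G.@[(a *: y + b *: u) ord0] =
  a ^+ 2 * G.@[y ord0] + a * b * dot (gradient G y) u + b ^+ 2 * G.@[u ord0].
Proof.
move=> hG; have two0 : 2%:R != 0 :> K by rewrite pnatr_eq0.
have hd i : G^`M(i) \is 1.-homog by have := dhomog_mderiv i hG.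
pose h i j := gradient (G^`M(i)) 0 j.
have hC i j : h i j = h j i by rewrite /h /gradient mderiv_comm.
have gE z i : gradient G z i = dot (h i) z by rewrite /gradient (line_meval z 0 (hd i)).
have GE (z : 'rV[K]_3) : G.@[z ord0] = 2%:R^-1 * \sum_i dot (h i) z * z ord0 i.
  apply: (mulfI two0); rewrite mulrA divff // mul1r mulr_natl -(euler_meval _ hG).
  by apply: eq_bigr => i _; rewrite gE.
rewrite !GE {2}/dot; under [X in _ + a * b * X + _]eq_bigr do rewrite gE.
rewrite !sum_ord3 /dot !sum_ord3 !mxE.
rewrite (hC i1 i0) (hC i2 i0) (hC i2 i1).
by field.
Qed.

Lemma line_lies_on F p y : F \is 1.-homog -> lies_on F p = (dot (gradient F y) (hvec p) == 0).
Proof. by move=> hF; rewrite /lies_on -(line_meval _ _ hF). Qed.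

Lemma lines_meet_once F G : is_line F -> is_line G -> zeros F <> zeros G ->
  exists p0, forall p, lies_on F p && lies_on G p = (p == p0).
Proof.
move=> lF lG neq; have [[hF _] [hG _]] := (lF, lG).
pose c := gradient F 0; pose l := gradient G 0.
have nc : exists i, c i != 0 by apply: line_gradient_neq0.
have nl : exists i, l i != 0 by apply: line_gradient_neq0.
have [u0 [u1 [free span]]] := dot_ker_basis nc.
have dl a b : dot l (a *: u0 + b *: u1) = a * dot l u0 + b * dot l u1.
  by rewrite dotD !dotZ.
have ab : (dot l u0 != 0) || (dot l u1 != 0).
  apply/negPn/negP; rewrite negb_or !negbK => /andP[/eqP l0 /eqP l1]; apply: neq.
  have ker : forall y, dot c y = 0 <-> dot l y = 0.
    by apply: dot_ker_eq => // y /span[a [b ->]]; rewrite dl l0 l1 !mulr0 addr0.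
  apply/seteqP; split=> p; rewrite /zeros /= (line_lies_on _ 0 hF) (line_lies_on _ 0 hG);
    by move=> /eqP/ker/eqP.
(* The vector of the plane c = 0, unique up to scalar, on which l vanishes. *)
pose u := dot l u1 *: u0 + (- dot l u0) *: u1.
have u_neq0 : u != 0.
  apply/eqP => /free[l1 /eqP]; rewrite oppr_eq0 => l0.
  by move: ab; rewrite l0 l1 eqxx.
have uP y : dot c y = 0 -> dot l y = 0 -> exists a, y = a *: u.
  move=> /span[a [b ->]]; rewrite dl => /eqP e.
  have [l1|l1] := eqVneq (dot l u1) 0.
    move: ab e; rewrite l1 eqxx orbF mulr0 addr0 mulf_eq0 => l0; rewrite (negPf l0) orbF => /eqP->.
    exists (- (b / dot l u0)); rewrite /u l1 scalerDr !scalerA mulr0 !scale0r !add0r.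
    by rewrite mulrNN divfK.
  exists (a / dot l u1); rewrite /u scalerDr !scalerA divfK //; congr (_ + _ *: _).
  by apply: (mulIf l1); move: e; rewrite addrC addr_eq0 => /eqP->; field.
have [p0 [s [s0 ep0]]] := exists_point u_neq0.
have cu : dot c u = 0 by apply/span; exists (dot l u1), (- dot l u0).
have lu : dot l u = 0 by rewrite dl; ring.
exists p0 => p; rewrite (line_lies_on _ 0 hF) (line_lies_on _ 0 hG).
apply/andP/eqP => [[/eqP cp /eqP lp]|->]; last by rewrite ep0 !dotZ cu lu mulr0.
have [a ea] := uP _ cp lp.
by apply: (@hvec_eq _ _ (a / s)); rewrite ea ep0 scalerA divfK.
Qed.

Lemma line_meets_conic F G : is_line F -> G \is 2.-homog ->
  exists p, lies_on F p && lies_on G p.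
Proof.
move=> lF hG; have [hF _] := lF.
have [u0 [u1 [free span]]] := dot_ker_basis (line_gradient_neq0 0 lF).
suff [a [b [ab Gab]]] : exists a b, a *: u0 + b *: u1 != 0 /\ G.@[(a *: u0 + b *: u1) ord0] = 0.
  have [p [s [s0 ep]]] := exists_point ab.
  exists p; rewrite (lies_onE hF s0 ep) (lies_onE hG s0 ep) Gab eqxx andbT.
  by rewrite (line_meval _ 0 hF); apply/eqP/span; exists a, b.
have [G1|G1] := eqVneq (G.@[u1 ord0]) 0.
  exists 0, 1; rewrite scale0r add0r scale1r; split => //.
  apply/eqP => u10; have /free[_ /eqP] : 0 *: u0 + 1 *: u1 = 0.
    by rewrite u10 scaler0 scale0r addr0.
  by rewrite oner_eq0.
(* The restriction of G to u0 + x u1; its leading coefficient G(u1) is nonzero in this case, so it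
   has a root. *)
pose q := Poly [:: G.@[u0 ord0]; dot (gradient G u0) u1; G.@[u1 ord0]].
have sq : size q = 3%N by rewrite (@PolyK _ 0).
have [|x] := elimT (closed_rootP q); first by rewrite sq.
rewrite /root horner_Poly /= => /eqP ex; exists 1, x; split.
  by apply/eqP => /free[/eqP]; rewrite oner_eq0.
by rewrite (quadric_meval _ _ _ _ hG) -[RHS]ex; ring.
Qed.

(* Transversality at one common point is enough: the restriction of the conic to
   the line is then a binary quadratic form with two distinct roots. *)
Lemma line_meets_conic_twice F G : is_line F -> smooth_conic G ->
    (forall p, lies_on F p -> lies_on G p -> tangent_line G p <> tangent_line F p) ->
  exists p0 p1, p0 != p1 /\ forall p, lies_on G p && lies_on F p = (p == p0) || (p == p1).
Proof.
move=> lF [hG smooth] transv; have [hF _] := lF.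
have [p0 /andP[F0 G0]] := line_meets_conic lF hG.
pose v := hvec p0; pose c := gradient F v.
have nc : exists i, c i != 0 by apply: line_gradient_neq0.
have cv : dot c v = 0 by apply/eqP; rewrite -(line_lies_on _ v hF).
have [u [free span]] := dot_ker_basis_at nc (hvec_neq0 p0) cv.
have Gv : G.@[v ord0] = 0 by apply/eqP; exact: G0.
pose m := dot (gradient G v) u.
have m0 : m != 0.
  apply/eqP => m0; case: (transv p0 F0 G0).
  have ker : forall y, dot c y = 0 <-> dot (gradient G v) y = 0.
    apply: dot_ker_eq => //; first exact: smooth.
    move=> y /span[a [b ->]]; rewrite dotD !dotZ (euler_meval _ hG) Gv mul0rn.
    by rewrite -/m m0 !mulr0 addr0.
  by apply/seteqP; split=> q /tangent_lineE /ker.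
(* On the line, G(a v + b u) = b (a m + b G(u)): the root b = 0 is [p0], and this is the other one,
   at b = 1. *)
pose z := (- (G.@[u ord0] / m)) *: v + 1 *: u.
have z0 : z != 0 by apply/eqP => /free[_ /eqP]; rewrite oner_eq0.
have [p1 [s [s0 ep1]]] := exists_point z0.
exists p0, p1; split.
  apply/eqP => e; have /free[_ /eqP] : (1 + s * (G.@[u ord0] / m)) *: v + (- s) *: u = 0.
    have : v - s *: z = 0 by rewrite -ep1 -e subrr.
    by rewrite /z scale1r scalerDr opprD addrA -scaleNr !scalerA mulrN mulNr opprK scalerDl scale1r scaleNr.
  by rewrite oppr_eq0 (negPf s0).
have Gab a b : G.@[(a *: v + b *: u) ord0] = b * (a * m + b * G.@[u ord0]).
  by rewrite (quadric_meval _ _ _ _ hG) Gv -/m; ring.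
move=> p; apply/andP/orP => [[Gp Fp]|[/eqP->|/eqP->]] //; last first.
  rewrite (lies_onE hF s0 ep1) (lies_onE hG s0 ep1) /z Gab; split.
    by apply/eqP; field.
  by rewrite (line_meval _ v hF); apply/eqP/span; exists (- (G.@[u ord0] / m)), 1.
move: Fp; rewrite (line_lies_on _ v hF) => /eqP/span[a [b ep]].
have : G.@[hvec p ord0] = 0 by apply/eqP; exact: Gp.
rewrite ep Gab => /eqP; rewrite mulf_eq0 => /orP[/eqP b0|/eqP ab].
  by left; apply/eqP; apply: (@hvec_eq _ _ a); rewrite ep b0 scale0r addr0.
right; apply/eqP; apply: (@hvec_eq _ _ (b / s)).
rewrite ep ep1 scalerA divfK // /z scale1r scalerDr scalerA; congr (_ *: _ + _).
by apply: (mulIf m0); move/eqP: ab; rewrite addr_eq0 => /eqP->; field.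
Qed.

End ProjectivePoints.

(** * Ordinary points of an arrangement *)

(** On the curve (1, t, t^2) every nonzero linear form becomes a nonzero polynomial in t, and some t
    avoids the roots of their product. *)
Lemma generic_vector (K : numClosedFieldType) (I : finType) (S : {set I})
    (l : I -> 'I_3 -> K) :
  (forall i, i \in S -> exists k, l i k != 0) ->
  exists u : 'rV[K]_3, forall i, i \in S -> dot (l i) u != 0.
Proof.
move=> nl; pose q i := Poly [:: l i i0; l i i1; l i i2].
have [t tP] : exists t, ~~ root (\prod_(i in S) q i) t.
  apply/closed_nonrootP/prodf_neq0 => i /nl[k]; apply: contraNneq => /polyP q0.
  have := q0 k; rewrite coef_Poly coef0; by case: (ord3_cases k) => -> /= ->.
exists (\row_(j < 3) t ^+ j) => i iS; move: tP; rewrite /root horner_prod => /prodf_neq0/(_ i iS).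
by rewrite horner_Poly /= /dot sum_ord3 !mxE /= => h; apply: contra_neq h => e; rewrite -[RHS]e; ring.
Qed.

Lemma complete_basis (K : fieldType) (u v : 'rV[K]_3) :
  (forall a b, a *: u + b *: v = 0 -> a = 0 /\ b = 0) ->
  exists B : 'M[K]_3, [/\ B \in unitmx, row i1 B = u & row i2 B = v].
Proof.
move=> free.
(* If all coordinate vectors lay in the span of u and v, the identity matrix of size 3 would factor
   through K^2. *)
have [j nj] : exists j : 'I_3, forall a b, delta_mx ord0 j != a *: u + b *: v.
  apply: contrapT => noj.
  have /choice[a /choice[b ab]] (j : 'I_3) : exists a b, delta_mx ord0 j = a *: u + b *: v.
    apply: contrapT => nab; apply: noj; exists j => a b.
    by apply/eqP => e; apply: nab; exists a, b.
  suff : (3 <= 2)%N by [].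
  pose M : 'M[K]_(2, 3) := \matrix_(k < 2) (if k == ord0 then u else v).
  apply: (@mulmx1_min _ _ _ (\matrix_(j, k) if k == ord0 then a j else b j) M).
  apply/row_matrixP => j; rewrite row_mul mulmx_sum_row row1 ab !big_ord_recl big_ord0.
  by rewrite !mxE !rowK /= addr0.
pose B : 'M[K]_3 := \matrix_(k < 3) (if k == i0 then delta_mx ord0 j else if k == i1 then u else v).
exists B; rewrite !rowK /=; split => //.
rewrite -row_free_unit; apply: inj_row_free => x.
rewrite mulmx_sum_row sum_ord3 !rowK /= => e.
have x0 : x ord0 i0 = 0.
  apply/eqP/negPn/negP => x0; have /negP := nj (- (x ord0 i1 / x ord0 i0)) (- (x ord0 i2 / x ord0 i0)).
  apply; apply/eqP/(@scalerI _ _ (x ord0 i0)) => //.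
  rewrite scalerDr !scalerA !mulrN ![x ord0 i0 * _]mulrC !divfK // !scaleNr -opprD; apply/eqP.
  by rewrite -addr_eq0 addrA e.
move: e; rewrite x0 scale0r add0r => /free[x1 x2].
by apply/rowP => k; rewrite mxE; case: (ord3_cases k) => ->.
Qed.

Lemma sqfree_prod_XsubC (F : fieldType) (c : F) (rs : seq F) :
  c != 0 -> uniq rs -> let P := c *: \prod_(x <- rs) ('X - x%:P) in
  size P = (size rs).+1 /\ coprimep P P^`().
Proof.
move=> c0 urs /=; rewrite size_scale // size_prod_XsubC; split=> //.
have := separable_prod_XsubC rs; rewrite urs unlock => cop.
by rewrite derivZ coprimepZl // coprimepZr.
Qed.

(** The linear term in t is the differential at v applied to the moving direction, a polynomial of
    degree at most 1 in w. *)
Lemma blowup_vanishing (K : numClosedFieldType) (B : 'M[K]_3) (a : {mpoly K[3]}) (v : 'rV[K]_3) :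
    row i2 B = v -> a.@[v ord0] = 0 ->
  exists r, blowup B a = 'X *
    (((dot (gradient a v) (row i0 B))%:P + (dot (gradient a v) (row i1 B)) *: 'X)%:P + 'X * r).
Proof.
move=> Bv av; have Bvi : v ord0 =1 (fun i => B i2 i) by move=> i; rewrite -Bv mxE.
have [r1 e1] : exists r, blowup B a = 'X * r.
  by apply: coef0_factor; rewrite blowup_coef0 -(meval_eq _ Bvi) av.
have dE j : (dir_deriv B j a).@[fun i => B i2 i] = dot (gradient a v) (row j B).
  rewrite -(meval_eq _ Bvi) /dir_deriv rmorph_sum; apply: eq_bigr => i _ /=.
  by rewrite mevalZ mxE mulrC.
have r10 : r1`_0 = (dot (gradient a v) (row i0 B))%:P + (dot (gradient a v) (row i1 B)) *: 'X.
  have /polyP/(_ 0%N) := deriv_blowup B a.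
  rewrite e1 coef_deriv coefXM mulr1n /= => ->.
  by rewrite coefD coefCM !blowup_coef0 !dE mulrC mul_polyC.
have [|r er] := @coef0_factor _ (r1 - (r1`_0)%:P); first by rewrite coefB coefC subrr.
by exists r; rewrite e1 -r10 -er addrC subrK.
Qed.

Lemma leading_form_mul (R : comNzRingType) (t t' x p p' r r' : R) :
  t * (p + x * r) * (t' * (p' + x * r')) =
  t * t' * (p * p' + x * (r' * p + r * p' + x * (r' * r))).
Proof. by ring. Qed.

Section ArrangementGerm.
Context {K : numClosedFieldType} {k d : nat} (A : arrangement K k d).
Implicit Types (p : proj_plane K).

Definition curve_degree (i : 'I_k + 'I_d) : nat := if i is inl _ then 2 else 1.

Lemma curve_homog i : A i \is (curve_degree i).-homog.
Proof.
by case: i => i /=; [case: (curve_conic A i)|case: (curve_line A i)].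
Qed.

Lemma arr_poly_homog : arr_poly A \is (\sum_i curve_degree i).-homog.
Proof.
rewrite /arr_poly; elim/big_rec2: _ => [|i m G _ hG]; first exact: dhomog1.
exact: dhomogM (curve_homog i) hG.
Qed.

Lemma curve_gradient_neq0 i p : lies_on (A i) p ->
  exists j, gradient (A i) (hvec p) j != 0.
Proof.
case: i => i; first by case: (curve_conic A i) => _; apply.
by move=> _; apply: line_gradient_neq0; apply: curve_line.
Qed.

Lemma lies_on_arr_poly p : lies_on (arr_poly A) p = [exists i, lies_on (A i) p].
Proof.
rewrite /lies_on /arr_poly rmorph_prod /=.
by apply/prodf_eq0/existsP => [[i _ h]|[i h]]; exists i.
Qed.

(** By the product rule two factors vanishing at p kill every partial; with a single one, the
    gradient is that of a smooth curve times nonzero values of the others. *)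
Lemma singular_pointP p : singular_point (arr_poly A) p <-> (2 <= num_through A p)%N.
Proof.
rewrite /num_through; split=> [[]|/card_gt1P[i [j [ip jp ij]]]]; last first.
  rewrite !inE in ip jp.
  split; first by rewrite lies_on_arr_poly; apply/existsP; exists i.
  move=> l; rewrite /arr_poly (bigD1 i) //= (bigD1 j) /=; last by rewrite eq_sym.
  by rewrite !mderivM !mevalD !mevalM (eqP ip) (eqP jp); ring.
rewrite lies_on_arr_poly => /existsP[i ip] sing; rewrite ltnNge; apply/negP => le1.
have only j : j != i -> ~~ lies_on (A j) p.
  move=> ji; apply: contraNN ji => jp; apply/eqP.
  by apply: (card_le1_eqP le1); rewrite inE.
have [l] := curve_gradient_neq0 ip; apply/negP; rewrite negbK.
have := sing l; rewrite /arr_poly (bigD1 i) //=.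
rewrite mderivM mevalD !mevalM (eqP ip) mul0r addr0 => /eqP; rewrite mulf_eq0 => /orP[//|].
rewrite rmorph_prod /= => /prodf_eq0[j ji jp].
by have := only j ji; rewrite /lies_on jp.
Qed.

Lemma num_through_sum p : num_through A p = (\sum_i lies_on (A i) p)%N.
Proof.
rewrite /num_through -sum1_card big_mkcond; apply: eq_bigr => i _.
by rewrite inE; case: (lies_on _ _).
Qed.

Lemma zero_locus_jacobian : (0 < k + d)%N ->
  zero_locus (jacobian_ideal (arr_poly A)) = [set p | (2 <= num_through A p)%N]%classic.
Proof.
move=> kd; have hA := arr_poly_homog.
have D0 : (0 < \sum_i curve_degree i)%N.
  have i : 'I_k + 'I_d.
    case: k kd => [|k'] kd; last by left; exact: ord0.
    by right; exact: (Ordinal kd).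
  by rewrite (bigD1 i) //= addn_gt0; case: i.
apply/seteqP; split=> p /=.
  move=> Zp; apply/singular_pointP; split.
    by apply: Zp; apply: (@jacobian_ideal_homog _ _ (\sum_i curve_degree i).-1); rewrite prednK.
  by move=> i; apply/eqP; apply: Zp; apply: jacobian_ideal_mderiv.
move=> /singular_pointP[_ sing] _ [c ->]; rewrite /lies_on rmorph_sum big1 // => i _ /=.
by rewrite mevalM sing mulr0.
Qed.

(** Both gradients vanish on [hvec p], so equal slopes on the other two basis vectors would make
    them proportional and the tangent lines equal. *)
Lemma ordinary_cross p s i j (u0 u1 : 'rV[K]_3) (B : 'M[K]_3) :
    B \in unitmx -> row i0 B = u0 -> row i1 B = u1 -> row i2 B = hvec p ->
    ordinary_point A p s -> i != j -> lies_on (A i) p -> lies_on (A j) p ->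
    dot (gradient (A i) (hvec p)) u1 != 0 -> dot (gradient (A j) (hvec p)) u1 != 0 ->
  dot (gradient (A i) (hvec p)) u0 / dot (gradient (A i) (hvec p)) u1 !=
  dot (gradient (A j) (hvec p)) u0 / dot (gradient (A j) (hvec p)) u1.
Proof.
move=> Bu B0 B1 B2 [_ _ tang] ij ip jp.
set li := gradient (A i) _; set lj := gradient (A j) _ => nli nlj.
apply/eqP => e; apply: (tang i j ij ip jp).
have ev l : lies_on (A l) p -> dot (gradient (A l) (hvec p)) (hvec p) = 0.
  by move=> /eqP lp; rewrite (euler_meval _ (curve_homog l)) lp mul0rn.
pose m l := dot li u1 * lj l - dot lj u1 * li l.
have dm y : dot m y = dot li u1 * dot lj y - dot lj u1 * dot li y.
  rewrite /dot !mulr_sumr -sumrB; apply: eq_bigr => l _; rewrite /m /dot; ring.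
have mB l : dot m (row l B) = 0.
  rewrite dm; case: (ord3_cases l) => ->; rewrite ?B0 ?B1 ?B2.
  - have -> : dot lj u0 = dot li u0 / dot li u1 * dot lj u1 by rewrite e divfK.
    by field.
  - by ring.
  - by rewrite !ev // !mulr0 subrr.
have m0 y : dot m y = 0.
  rewrite -[y]mulmx1 -(mulVmx Bu) mulmxA mulmx_sum_row sum_ord3 !dotD !dotZ !mB.
  by rewrite !mulr0 !addr0.
have prop y : dot li u1 * dot lj y = dot lj u1 * dot li y.
  by apply/eqP; rewrite -subr_eq0 -dm m0.
apply/seteqP; split=> q /tangent_lineE; rewrite -/li -/lj => /eqP h; apply/tangent_lineE;
  rewrite -/li -/lj; apply/eqP.
  by have /eqP := prop (hvec q); rewrite (eqP h) mulr0 mulf_eq0 (negPf nli).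
by have /eqP := prop (hvec q); rewrite (eqP h) mulr0 eq_sym mulf_eq0 (negPf nlj).
Qed.

(** The leading form of the arrangement is the product of those of its curves: a linear polynomial
    in w for each curve through p, a nonzero constant for every other one. Its roots are the negated
    slopes, which [ordinary_cross] separates. *)
Theorem ordinary_point_tjurina p s N : ordinary_point A p s -> (2 <= s <= 4)%N ->
  local_length (jacobian_ideal (arr_poly A)) p N -> N = (s.-1 ^ 2)%N.
Proof.
move=> op /andP[s2 s4] lenN; have [_ cs _] := op.
pose S := [set i | lies_on (A i) p]%SET.
have cS : #|S| = s by exact: cs.
pose l i := gradient (A i) (hvec p).
(* [u1] is the direction w = infinity of the chart; avoiding all tangents keeps each linear factor
   of degree exactly 1. *)
have [u1 u1P] : exists u : 'rV[K]_3, forall i, i \in S -> dot (l i) u != 0.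
  by apply: generic_vector => i; rewrite inE => /curve_gradient_neq0.
have [iS iSP] : exists i, i \in S by apply/card_gt0P; rewrite cS ltnW.
have [B [Bu B1 B2]] : exists B : 'M[K]_3, [/\ B \in unitmx, row i1 B = u1 & row i2 B = hvec p].
  apply: complete_basis => a b e.
  have ev : dot (l iS) (hvec p) = 0.
    by move: (iSP); rewrite inE => /eqP lp; rewrite (euler_meval _ (curve_homog _)) lp mul0rn.
  have a0 : a = 0.
    have : dot (l iS) (a *: u1 + b *: hvec p) = 0 by rewrite e -(scale0r 0) dotZ mul0r.
    rewrite dotD !dotZ ev mulr0 addr0 => /eqP.
    by rewrite mulf_eq0 (negPf (u1P _ iSP)) orbF => /eqP.
  split=> //; move: e; rewrite a0 scale0r add0r => /eqP.
  by rewrite scaler_eq0 (negPf (hvec_neq0 p)) orbF => /eqP.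
pose P i : {poly K} := if i \in S then (dot (l i) (row i0 B))%:P + dot (l i) u1 *: 'X
                       else ((A i).@[hvec p ord0])%:P.
pose rs := [seq - (dot (l i) (row i0 B) / dot (l i) u1) | i <- enum S].
pose c := (\prod_(i in S) dot (l i) u1) * \prod_(i | i \notin S) (A i).@[hvec p ord0].
have PE : \prod_i P i = c *: \prod_(x <- rs) ('X - x%:P).
  rewrite (bigID (mem S)) /= /rs big_map big_enum /c /=.
  have -> : \prod_(i in S) P i = (\prod_(i in S) dot (l i) u1) *:
      \prod_(i in S) ('X - (- (dot (l i) (row i0 B) / dot (l i) u1))%:P).
    rewrite -scaler_prod; apply: eq_bigr => i iS'; rewrite /P iS'.
    rewrite polyCN opprK scalerDr addrC -!mul_polyC -polyCM; congr (_ + _%:P).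
    by rewrite mulrCA divff ?mulr1 // u1P.
  have -> : \prod_(i | i \notin S) P i = (\prod_(i | i \notin S) (A i).@[hvec p ord0])%:P.
    by rewrite rmorph_prod; apply: eq_bigr => i /negPf iS'; rewrite /P iS'.
  by rewrite mulrC mul_polyC scalerA mulrC.
have c0 : c != 0.
  rewrite mulf_neq0 //; first by apply/prodf_neq0 => i; apply: u1P.
  by apply/prodf_neq0 => i; rewrite inE.
have urs : uniq rs.
  rewrite map_inj_in_uniq ?enum_uniq // => i j; rewrite !mem_enum => iS' jS' /oppr_inj e.
  apply/eqP/negPn/negP => ij.
  move: (iS') (jS'); rewrite !inE => ip jp.
  have /eqP := ordinary_cross Bu erefl B1 B2 op ij ip jp (u1P _ iS') (u1P _ jS').
  exact.
have [] := sqfree_prod_XsubC c0 urs; rewrite -PE => sP cP.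
have [r er] : exists r, blowup B (arr_poly A) =
    'X ^+ (\sum_i (i \in S)) * ((\prod_i P i)%:P + 'X * r).
  rewrite /arr_poly; elim/big_rec3: _ => [|i P' m G _ [r er]].
    by exists 0; rewrite rmorph1 mulr0 addr0 mul1r.
  have [r' er'] : exists r', blowup B (A i) = 'X ^+ (i \in S) * ((P i)%:P + 'X * r').
    rewrite /P; case: ifPn => iS'.
      by rewrite -B1 expr1; apply: blowup_vanishing => //; move: iS'; rewrite inE => /eqP.
    have [|r' er'] := @coef0_factor _ (blowup B (A i) - ((A i).@[hvec p ord0])%:P%:P).
      rewrite coefB coefC blowup_coef0 -B2 /=; apply/eqP; rewrite subr_eq0; apply/eqP.
      by congr polyC; apply: meval_eq => j; rewrite mxE.
    by exists r'; rewrite expr0 mul1r -er' addrC subrK.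
  exists (r * (P i)%:P + r' * (P'%:P) + 'X * (r * r')).
  by rewrite rmorphM /= er er' exprD polyCM; apply: leading_form_mul.
have sumS : (\sum_i (i \in S))%N = s.-2.+2.
  by rewrite -big_mkcond sum1_card cS; case: (s) s2 => [|[]].
have hA := arr_poly_homog; have D0 : (0 < \sum_i curve_degree i)%N.
  by rewrite (bigD1 iS) //= addn_gt0; case: (iS).
rewrite -(prednK D0) in hA.
have Bp i : B i2 i = hcoord p i by rewrite /hcoord -/(hvec p) -B2 mxE.
apply: (tjurina_of_leading_form Bu Bp hA _ _ cP _ lenN).
- by rewrite er; congr (_ ^+ _ * _); rewrite sumS; move: s2; case: (s) => [|[]].
- by rewrite sP size_map -cardE cS; move: s2; case: (s) => [|[]].
- by move: s2 s4; case: (s) => [|[]].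
Qed.

End ArrangementGerm.

(** * Counting multiple points *)

Section Counting.
Context {K : numClosedFieldType} {d : nat} (A : arrangement K 1 d).
Implicit Types (p : proj_plane K).
Local Notation on i p := (lies_on (A i) p).
Local Notation s p := (num_through A p).

Section OverMultiplePoints.
Context (Z : {fset proj_plane K}) (memZ : forall p, (p \in Z) = (2 <= s p)%N).

Lemma mult_ge2 i j p : i != j -> on i p -> on j p -> (2 <= s p)%N.
Proof.
move=> ij ip jp; rewrite num_through_sum (bigD1 i) //= (bigD1 j) /=; last by rewrite eq_sym.
by rewrite ip jp.
Qed.

Lemma sum_pred1 p0 : p0 \in Z -> (\sum_(p <- Z) (p == p0))%N = 1%N.
Proof.
by move=> p0Z; rewrite (bigD1_seq p0) ?fset_uniq // eqxx big1 // => p /negPf ->.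
Qed.

(** s (s - 1) counts the ordered pairs of distinct curves through a point. *)
Lemma sum_pairs :
  (\sum_(p <- Z) s p * (s p).-1 =
   \sum_i \sum_(j | j != i) \sum_(p <- Z) (on i p && on j p))%N.
Proof.
under [RHS]eq_bigr do rewrite exchange_big.
rewrite exchange_big; apply: eq_bigr => p _ /=.
rewrite {1}num_through_sum big_distrl; apply: eq_bigr => i _ /=.
case ip: (on i p); last by rewrite mul0n big1.
by rewrite mul1n num_through_sum (bigD1 i) //= ip.
Qed.

Hypothesis ordinary : forall p, (2 <= s p)%N -> ordinary_point A p (s p).

Lemma meet_lines j l : j != l -> (\sum_(p <- Z) (on (inr j) p && on (inr l) p) = 1)%N.
Proof.
move=> jl; have [p0 p0P] : exists p0, forall p, on (inr j) p && on (inr l) p = (p == p0).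
  apply: lines_meet_once; [exact: curve_line|exact: curve_line|].
  by move=> /(@curve_distinct _ _ _ A (inr j) (inr l)) [] /eqP; rewrite (negPf jl).
under eq_bigr do rewrite p0P; apply: sum_pred1; rewrite memZ.
have /andP[ip lp] : on (inr j) p0 && on (inr l) p0 by rewrite p0P.
by apply: (mult_ge2 _ ip lp).
Qed.

Lemma meet_conic_line i j : (\sum_(p <- Z) (on (inl i) p && on (inr j) p) = 2)%N.
Proof.
have [|p0 [p1 [p01 pP]]] := @line_meets_conic_twice _ _ _ (curve_line A j) (curve_conic A i).
  move=> p jp ip; have s2 := @mult_ge2 (inl i) (inr j) p isT ip jp.
  by have [_ _] := ordinary s2; apply.
transitivity (\sum_(p <- Z) ((p == p0) + (p == p1)))%N.
  apply: eq_bigr => p _; rewrite pP; have [->|] := eqVneq p p0; last by [].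
  by rewrite (negPf p01).
have p0Z : p0 \in Z.
  have /andP[ip jp] : on (inl i) p0 && on (inr j) p0 by rewrite pP eqxx.
  by rewrite memZ; apply: (@mult_ge2 (inl i) (inr j)).
have p1Z : p1 \in Z.
  have /andP[ip jp] : on (inl i) p1 && on (inr j) p1 by rewrite pP eqxx orbT.
  by rewrite memZ; apply: (@mult_ge2 (inl i) (inr j)).
rewrite big_split -[RHS]/(1 + 1)%N; congr addn; first exact: (sum_pred1 p0Z).
exact: (sum_pred1 p1Z).
Qed.

(** Summation by the first curve of the pair: the conic contributes 2d, and each line contributes 2
    + (d - 1). *)
Lemma bezout_count : (\sum_(p <- Z) s p * (s p).-1 = d ^ 2 + 3 * d)%N.
Proof.
have row_conic : (\sum_(j | j != inl ord0) \sum_(p <- Z) (on (inl ord0) p && on j p) = d * 2)%N.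
  rewrite big_sumType /= big_pred0 => [|i]; last by rewrite ord1 eqxx.
  rewrite [LHS](eq_bigr (fun=> 2%N)) => [|j _]; last exact: meet_conic_line.
  by rewrite sum_nat_const card_ord.
have row_line (j : 'I_d) : (\sum_(l | l != inr j) \sum_(p <- Z) (on (inr j) p && on l p) = d.+1)%N.
  rewrite big_sumType /= big_ord1.
  under eq_bigr do rewrite andbC.
  rewrite meet_conic_line (eq_bigr (fun=> 1%N)) => [|l lj]; last first.
    by apply: meet_lines; rewrite eq_sym.
  rewrite (eq_bigl (fun l => l != j)) // sum1_card cardC1 card_ord.
  by case: (d) j => [[]|].
rewrite sum_pairs big_sumType /= big_ord1 row_conic (eq_bigr (fun=> d.+1)) //.
by rewrite sum_nat_const card_ord; lia.
Qed.

(** At each point s (s - 1) = (s - 1) + (s - 1)^2. *)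
Lemma excess_count T : T = (\sum_(p <- Z) (s p).-1 ^ 2)%N ->
  (\sum_(p <- Z) (s p).-1 + T = d ^ 2 + 3 * d)%N.
Proof.
move=> ->; rewrite -big_split -bezout_count; apply: eq_big_seq => p; rewrite memZ /=.
by case: (s p) => // m _ /=; rewrite -mulnn mulSn.
Qed.

(** * Removing the conic *)

Local Notation sL p := (num_through (lines_of A) p).

Lemma num_through_lines p : s p = (on (inl ord0) p + sL p)%N.
Proof.
rewrite !num_through_sum !big_sumType /= big_ord1 big_ord0 add0n.
by congr addn; apply: eq_bigr.
Qed.

Lemma num_points_lines t : (2 <= t)%N ->
  num_points (lines_of A) t = (\sum_(p <- Z) (sL p == t))%N.
Proof.
move=> t2; rewrite /num_points.
have -> : [set p | sL p = t]%classic = [set` [fset p in Z | sL p == t]%fset]%classic.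
  apply/seteqP; split=> p /=; rewrite !inE /= memZ; last by move=> /andP[_ /eqP].
  by move=> e; rewrite num_through_lines e eqxx andbT (leq_trans t2) // leq_addl.
rewrite set_fsetK card_fset_sum1 big_fset /= big_mkcond; apply: eq_bigr => p _.
by case: eqP.
Qed.

Lemma num_through_lines_le p : (sL p <= d)%N.
Proof.
apply: (leq_trans (max_card _)); by rewrite card_sum !card_ord.
Qed.

(** Double counting over the multiple points of the whole arrangement; those on at most one line
    contribute 0 on the right because the predecessor is truncated. *)
Lemma sum_num_points_lines :
  (\sum_(2 <= t < d.+1) t.-1 * num_points (lines_of A) t = \sum_(p <- Z) (sL p).-1)%N.
Proof.
under eq_big_nat => t /andP[t2 _] do rewrite num_points_lines // big_distrr /=.
rewrite exchange_big; apply: eq_bigr => p _ /=.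
have [sl|sl] := leqP 2 (sL p).
  rewrite (bigD1_seq (sL p)) ?iota_uniq //=; last first.
    by rewrite mem_index_iota sl ltnS num_through_lines_le.
  rewrite eqxx muln1 big1 ?addn0 // => t; rewrite eq_sym => /negPf->.
  by rewrite muln0.
rewrite big_nat big1 => [|t /andP[t2 _]].
  by case: (sL p) sl => [|[]].
by rewrite (ltn_eqF (leq_trans sl t2)) muln0.
Qed.

(** A point of the conic on some line is a multiple point; conversely, as there is only one conic, a
    multiple point on it lies on a line. *)
Lemma conic_line_count :
  (#|` fset_set (conic_line_points A)| = \sum_(p <- Z) on (inl ord0) p)%N.
Proof.
have -> : conic_line_points A = [set` [fset p in Z | on (inl ord0) p]%fset]%classic.
  apply/seteqP; split=> p /=; rewrite !inE /= memZ.
    by move=> [ip [j jp]]; rewrite ip andbT; apply: (@mult_ge2 (inl ord0) (inr j)).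
  move=> /andP[s2 ip]; split=> //; move: s2.
  rewrite num_through_sum big_sumType /= big_ord1 ip add1n ltnS lt0n sum_nat_eq0.
  by rewrite negb_forall => /existsP[j]; rewrite eqb0 negbK => jp; exists j.
rewrite set_fsetK card_fset_sum1 big_fset /= big_mkcond; apply: eq_bigr => p _.
by case: (on _ p).
Qed.

(** A multiple point on the conic lies on at least one line, so s - 1 exceeds the truncated sL - 1
    by exactly one there, and equals it off the conic. *)
Lemma lines_count T : T = (\sum_(p <- Z) (s p).-1 ^ 2)%N ->
  (\sum_(2 <= t < d.+1) t.-1 * num_points (lines_of A) t
    + #|` fset_set (conic_line_points A)| + T = d ^ 2 + 3 * d)%N.
Proof.
move=> eT; rewrite -(excess_count eT) sum_num_points_lines conic_line_count -big_split.
congr addn; apply: eq_big_seq => p; rewrite memZ num_through_lines /=.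
by case: (on _ p) => /=; lia.
Qed.

End OverMultiplePoints.

Lemma lines_count_degree T : only_ordinary A 4 -> has_degree (jacobian_ideal (arr_poly A)) T ->
  (\sum_(2 <= t < d.+1) t.-1 * num_points (lines_of A) t
    + #|` fset_set (conic_line_points A)| + T = d ^ 2 + 3 * d)%N.
Proof.
move=> ord4 [finZ [tau [len eT]]].
have ZE : zero_locus (jacobian_ideal (arr_poly A)) = [set p | (2 <= s p)%N]%classic.
  exact: zero_locus_jacobian.
pose Z := fset_set (zero_locus (jacobian_ideal (arr_poly A))).
have memZ p : (p \in Z) = (2 <= s p)%N.
  by rewrite in_fset_set // ZE; apply/idP/idP; rewrite inE.
have ordP p : (2 <= s p)%N -> ordinary_point A p (s p) /\ (s p <= 4)%N.
  by move=> /singular_pointP/ord4[m m4 om]; have [_ -> _] := om.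
apply: (lines_count memZ); first by move=> p /ordP[].
rewrite eT; apply: eq_big_seq => p; rewrite -/Z memZ => s2.
have [op s4] := ordP p s2; apply: (ordinary_point_tjurina op); first by rewrite s2.
by apply: len; rewrite ZE.
Qed.

Lemma poincare_lines :
  poincare (lines_of A) =
  ((\sum_(2 <= t < d.+1) t.-1 * num_points (lines_of A) t)%N%:Z - d%:Z + 1) *: 'X^2
  + (d%:Z - 1) *: 'X + 1.
Proof.
have sumE : \sum_(2 <= t < d.+1) (t%:Z - 1) * (num_points (lines_of A) t)%:Z =
    (\sum_(2 <= t < d.+1) t.-1 * num_points (lines_of A) t)%N%:Z :> int.
  rewrite (big_morph Posz PoszD (erefl _)); apply: eq_big_nat => t /andP[t2 _].
  by rewrite PoszM predn_int // (leq_trans _ t2).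
by rewrite /poincare muln0 !add0n sumE addrC [1 + _]addrC addrA.
Qed.

End Counting.

Theorem theorem4p3 (R : realType) (d : nat) (d_ge3 : (3 <= d)%N)
    (CL : arrangement R[i] 1 d) (CL_M : M_arrangement CL)
    (r : nat) (CL_fin : finite_set (conic_line_points CL))
    (r_def : r = #|` fset_set (conic_line_points CL) |%N) :
  (forall l : nat, d = (2 * l)%N -> (4 <= d)%N ->
     poincare (lines_of CL) =
       ((l ^ 2 + l)%N%:Z - 2 - r%:Z) *: 'X^2 + ((2 * l)%N%:Z - 1) *: 'X + 1) /\
  (forall l : nat, d = (2 * l + 1)%N -> (3 <= d)%N ->
     poincare (lines_of CL) =
       ((l ^ 2 + 2 * l)%N%:Z - r%:Z) *: 'X^2 + (2 * l)%N%:Z *: 'X + 1).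
Proof.
have [_ ord4 _ deg] := CL_M.
(* The degree of the arrangement is d + 2, so the parameter m of the degree condition is l + 1 in
   both parities. *)
split=> l dE _; have [deg_even deg_odd] := deg l.+1; rewrite poincare_lines.
  have dl : arr_degree CL = (2 * l.+1)%N by rewrite /arr_degree dE; lia.
  have := lines_count_degree ord4 (deg_even dl); rewrite -r_def.
  (* Removes the truncated subtraction before passing to integers. *)
  have -> : (3 * l.+1 ^ 2 - 3 * l.+1 + 3 = 3 * l ^ 2 + 3 * l + 3)%N by nia.
  move: (\sum_(2 <= t < d.+1) _)%N => n; rewrite dE => e.
  by congr (_ *: _ + _ *: _ + _); nia.
have dl : arr_degree CL = (2 * l.+1 + 1)%N by rewrite /arr_degree dE; lia.
have := lines_count_degree ord4 (deg_odd dl); rewrite -r_def.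
move: (\sum_(2 <= t < d.+1) _)%N => n; rewrite dE => e.
congr (_ *: _ + _ *: _ + _); [nia|lia].
Qed.
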